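(* Let $\Omega\subset\mathbb{R}^d$ be a bounded, open domain and $\delta_0>0$. Let $u^0$ be the exact solution of the local problem $$-\Delta u^0=f_0\ \text{ in }\Omega,\qquad u^0=0\ \text{ on }\partial\Omega,$$ and assume that it is sufficiently smooth, i.e. $u^0\in C^4(\overline{\Omega_{\delta_0}})$. Let the sources $f_\delta$ satisfy $\max_{x\in\Omega}|f_\delta(x)-f_0(x)|=O(\delta^2)$. Fix the ratio $M_0=\delta/h_{\max}>0$. For any $\delta\in(0,\delta_0]$ let $u^{\delta,\epsilon,h}\in S(\square\cap\Omega)$ be the numerical solution of the collocation scheme with meshfree integration $$-\mathcal{L}^\epsilon_\delta u^{\delta,\epsilon,h}(x_{\mathbf k})=f_\delta(x_{\mathbf k})\quad\text{for all }x_{\mathbf k}\in\square\cap\Omega .$$ Then $$\|u^0-u^{\delta,\epsilon,h}\|_{L^2(\Omega)}\le C\,(h_{\max}^2+\delta^2),$$ with $C$ independent of $h_{\max}$ and $\delta$.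
   Context: Kernel. Let $d\ge1$ be an integer and let $\rho\ge0$ be a nonincreasing radial profile with $\rho(|s|)$ supported in the unit ball $B_1(0)\subset\mathbb{R}^d$ and $\int_{B_1(0)}\rho(|s|)|s|^2\,ds=2d$. For $\delta>0$ put $\rho_\delta(r)=\delta^{-(d+2)}\rho(r/\delta)$. Domains. $\Omega_{\delta_0}=\Omega\cup\{x\in\mathbb{R}^d\setminus\Omega:\operatorname{dist}(x,\Omega)\le\delta_0\}$. Grid. Fix $\hat{\mathbf h}=(\hat h_1,\dots,\hat h_d)$ with positive entries and $\max_j\hat h_j=1$. For $h_{\max}>0$ let $\mathbf h=(h_1,\dots,h_d)=h_{\max}\hat{\mathbf h}$, $x_{\mathbf k}=(k_1h_1,\dots,k_dh_d)$ for $\mathbf k\in\mathbb{Z}^d$, and $\square=\{x_{\mathbf k}:\mathbf k\in\mathbb{Z}^d\}$. Window function: $\phi(t)=\frac23-4t^2+4t^3$ for $0\le t\le\frac12$, $\phi(t)=\frac43(1-t)^3$ for $\frac12\le t\le1$, $\phi(t)=0$ for $t>1$. Linear reproducing kernel (RK) basis: $\Psi_{\mathbf k}(x)=\prod_{j=1}^d\phi\!\left(\frac{|x_j-k_jh_j|}{2h_j}\right)$. The trial space is $S(\square\cap\Omega)=\{\sum_{\mathbf k\in\mathbb{Z}^d}u_{\mathbf k}\Psi_{\mathbf k}: u_{\mathbf k}\in\mathbb{R},\ u_{\mathbf k}=0\text{ whenever }x_{\mathbf k}\notin\square\cap\Omega\}$. Quadrature points. $B^{\epsilon_1}_1(0)$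 is a fixed finite set of points in the unit ball of $\mathbb{R}^d$, with $N_d\ge4d$ elements ($N_d$ depending only on $d$), invariant under changing the sign of any coordinate and under any permutation of coordinates; $\epsilon_1$ denotes the spacing of the points. With $\widetilde m_{\alpha}=\sum_{s\in B^{\epsilon_1}_1(0)}s^{\alpha}\rho(|s|)\phi(|s|)$ for multi-indices $\alpha$, the weights are $$\omega(s)=\frac{\phi(|s|)\,|s|^2}{\widetilde m_4}\ (d=1),\qquad \omega(s)=\frac{\phi(|s|)\,|s|^2}{(d-1)\widetilde m_{220\cdots0}+\widetilde m_{40\cdots0}}\ (d\ge2)$$ (a term with $s=0$, if any, is read as zero). Quasi-discrete operator. With $\epsilon=\delta\epsilon_1$, $B^\epsilon_\delta(0)=\{\delta s:s\in B^{\epsilon_1}_1(0)\}$ and $\omega_\delta(s)=\delta^d\omega(s/\delta)$, $$\mathcal{L}^\epsilon_\delta u(x)=2\sum_{s\in B^\epsilon_\delta(0)}\omega_\delta(s)\rho_\delta(|s|)\,(u(x+s)-u(x)).$$ The data $d,\rho,\hat{\mathbf h},\Omega,\delta_0,M_0,B^{\epsilon_1}_1(0),u^0$ and the family $(f_\delta)$ are fixed.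
   Formalization: The assumption that u^0 is C^4 on the closure of Omega_{delta_0} is taken for u^0 extended by zero outside Omega (for an arbitrary C^4 extension the claim fails, e.g. u^0=x(1-x)/2 on (0,1)); the denominator of the weights omega is assumed nonzero. *)

(* Defs.v *)
From HB Require Import structures.
From mathcomp Require Import all_boot all_order all_fingroup all_algebra finmap.
From mathcomp Require Import all_classical all_reals all_analysis.

Set Implicit Arguments.
Unset Strict Implicit.
Unset Printing Implicit Defensive.
Import Order.TTheory GRing.Theory Num.Theory.
Import numFieldNormedType.Exports.

Local Open Scope classical_set_scope.
Local Open Scope ring_scope.

(* The n-fold product of a sigma-finite measure m, on n.-tuple T with the
   library's product sigma-algebra: product_tuple m n.+1 is the image of
   m \x product_tuple m n under (x, t) |-> x :: t. *)
Section product_tuple.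
Context {d} {T : measurableType d} {R : realType}.
Variable m : {sigma_finite_measure set T -> \bar R}.

Section cons_measure.
Context (n : nat) (mu : {sigma_finite_measure set (n.-tuple T) -> \bar R}).

Definition tuple_cons (p : T * n.-tuple T) : n.+1.-tuple T :=
  [the n.+1.-tuple T of p.1 :: p.2].

Lemma measurable_tuple_cons : measurable_fun [set: T * n.-tuple T] tuple_cons.
Proof. exact: measurable_cons. Qed.

Definition cons_measure : set (n.+1.-tuple T) -> \bar R :=
  pushforward (m \x mu)%E tuple_cons.

Let cons_measure0 : cons_measure set0 = 0%E.
Proof. by rewrite /cons_measure /pushforward preimage_set0 measure0. Qed.

Let cons_measure_ge0 A : (0 <= cons_measure A)%E.
Proof. by rewrite /cons_measure /pushforward; apply: measure_ge0. Qed.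

Let cons_measure_sigma_additive : semi_sigma_additive cons_measure.
Proof.
move=> F mF tF mUF; rewrite /cons_measure /pushforward preimage_bigcup.
have mP A : measurable A -> measurable (tuple_cons @^-1` A).
  by move=> mA; rewrite -[X in measurable X]setTI; exact: measurable_tuple_cons.
apply: measure_semi_sigma_additive.
- by move=> k; apply: mP; exact: mF.
- apply/trivIsetP => /= i j _ _ ij; rewrite -preimage_setI.
  by move/trivIsetP : tF => /(_ _ _ _ _ ij) ->//; rewrite preimage_set0.
- by rewrite -preimage_bigcup; exact: mP.
Qed.

HB.instance Definition _ := isMeasure.Build _ _ _ cons_measure
  cons_measure0 cons_measure_ge0 cons_measure_sigma_additive.

Let cons_measure_sigma_finite : sigma_finite setT cons_measure.
Proof.
have /sigma_finiteP[F [FT ndF Foo]] := sigma_finiteT m.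
have /sigma_finiteP[G [GT ndG Goo]] := sigma_finiteT mu.
pose g (t : n.+1.-tuple T) : T * n.-tuple T :=
  (thead t, [tuple of behead t]).
have mg : measurable_fun setT g.
  apply: measurable_fun_pair => /=.
    exact: (@measurable_tnth _ T n.+1 ord0).
  exact: measurable_behead.
have consK p : g (tuple_cons p) = p.
  by case: p => x t; congr pair; apply/val_inj.
exists (fun k => g @^-1` (F k `*` G k)).
  rewrite -preimage_bigcup (_ : \bigcup_k _ = setT) ?preimage_setT//.
  rewrite -subTset => -[x t] _.
  have [i _ Fix] : (\bigcup_k F k) x by rewrite -FT.
  have [j _ Gjt] : (\bigcup_k G k) t by rewrite -GT.
  exists (maxn i j) => //; split => /=.
    by move: x Fix; exact/subsetPset/ndF/leq_maxl.
  by move: t Gjt; exact/subsetPset/ndG/leq_maxr.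
move=> k; have [mFk Fkoo] := Foo k; have [mGk Gkoo] := Goo k; split.
  by rewrite -[X in measurable X]setTI; apply: mg => //; exact: measurableX.
rewrite /cons_measure /pushforward -comp_preimage.
rewrite (_ : g \o tuple_cons = id); last exact/funext.
by rewrite product_measure1E// lte_mul_pinfty// ge0_fin_numE.
Qed.

HB.instance Definition _ := Measure_isSigmaFinite.Build _ _ _ cons_measure
  cons_measure_sigma_finite.

End cons_measure.

Fixpoint product_tuple (n : nat) :
    {sigma_finite_measure set (n.-tuple T) -> \bar R} :=
  match n with
  | 0 => [the {sigma_finite_measure set (0.-tuple T) -> \bar R}
          of dirac ([tuple] : 0.-tuple T)]
  | n.+1 => [the {sigma_finite_measure set (n.+1.-tuple T) -> \bar R}
             of cons_measure (product_tuple n)]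
  end.

End product_tuple.

Definition lebesgue_tuple {R : realType} (n : nat) :
    {sigma_finite_measure set (n.-tuple (measurableTypeR R)) -> \bar R} :=
  product_tuple [the {sigma_finite_measure set (measurableTypeR R) -> \bar R}
                 of @lebesgue_measure R] n.

Section analysis_on_Rd.
Context {R : realType} {d : nat}.
Implicit Types (x s : 'rV[R]_d) (A : set 'rV[R]_d) (u : 'rV[R]_d -> R).

(* The norm `|x| that the library puts on 'rV[R]_d is the sup norm. *)
Definition enorm x : R := Num.sqrt (\sum_(j < d) x 0 j ^+ 2).

Definition row_of_tuple (t : d.-tuple (measurableTypeR R)) : 'rV[R]_d :=
  \row_(j < d) tnth t j.

Definition integral_on A (g : 'rV[R]_d -> R) : \bar R :=
  (\int[lebesgue_tuple d]_(t in row_of_tuple @^-1` A)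
     (g (row_of_tuple t))%:E)%E.

(* The boundary value problem determines u only in closure Omega. Its values
   outside are those that the nonlocal volume constraint prescribes, namely 0,
   which is also what the coefficients of trial_space enforce there. *)
Definition zero_ext A u x : R := if x \in A then u x else 0.

Definition L2norm_on A u : \bar R :=
  Lnorm (lebesgue_tuple d) 2%:E
    (fun t => (zero_ext A u (row_of_tuple t))%:E).

Definition partial (j : 'I_d) u : 'rV[R]_d -> R :=
  fun x => 'D_(delta_mx 0 j) u x.

Definition iter_partial (js : seq 'I_d) u : 'rV[R]_d -> R :=
  foldr partial u js.

Definition laplacian u x : R := \sum_(j < d) partial j (partial j u) x.

(* u is in C^k(closure A): inside A all partial derivatives of order at most k
   exist, and each of them extends continuously to closure A. *)
Definition Ck_closure (k : nat) A u : Prop :=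
  {within closure A, continuous u} /\
  forall js : seq 'I_d, (size js <= k)%N ->
    ((size js < k)%N -> forall (j : 'I_d) x, A^° x ->
       derivable (iter_partial js u) x (delta_mx 0 j)) /\
    exists2 g : 'rV[R]_d -> R, {within closure A, continuous g} &
      forall x, A^° x -> g x = iter_partial js u x.

Definition edist_to A x : R := inf [set enorm (x - y) | y in A].

Definition enlarge (Omega : set 'rV[R]_d) (delta0 : R) : set 'rV[R]_d :=
  Omega `|` [set x | ~ Omega x /\ edist_to Omega x <= delta0].

Definition bounded_domain (Omega : set 'rV[R]_d) : Prop :=
  [/\ Omega !=set0, open Omega, connected Omega & bounded_set Omega].

(* Omega is open, so its boundary is closure Omega `\` Omega. *)
Definition poisson_solution (Omega : set 'rV[R]_d) (f0 u0 : 'rV[R]_d -> R) :=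
  (forall x, Omega x -> - laplacian u0 x = f0 x) /\
  (forall x, (closure Omega `\` Omega) x -> u0 x = 0).

End analysis_on_Rd.

(* The profile may be singular at 0, so nothing is required of rho at 0; every
   use of rho 0 below is multiplied by zero. *)
Definition kernel_profile (R : realType) (d : nat) (rho : R -> R) : Prop :=
  [/\ forall r : R, 0 < r -> 0 <= rho r,
      forall r r' : R, 0 < r -> r <= r' -> rho r' <= rho r,
      forall r : R, 1 < r -> rho r = 0 &
      integral_on [set s : 'rV[R]_d | enorm s < 1]
        (fun s => rho (enorm s) * enorm s ^+ 2) = (2 * d%:R)%:E].

Definition scaled_profile (R : realType) (d : nat) (rho : R -> R) (delta r : R) : R :=
  delta ^- (d + 2) * rho (r / delta).

Section reproducing_kernel.
Context {R : realType} {d : nat}.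
Implicit Types (h x : 'rV[R]_d) (k : 'rV[int]_d).

(* Meant for t >= 0. *)
Definition window (t : R) : R :=
  if t <= 2^-1 then 2 / 3 - 4 * t ^+ 2 + 4 * t ^+ 3
  else if t <= 1 then 4 / 3 * (1 - t) ^+ 3
  else 0.

Definition grid_point h k : 'rV[R]_d := \row_(j < d) ((k 0 j)%:~R * h 0 j).

Definition grid h : set 'rV[R]_d := range (grid_point h).

Definition rk_basis h k x : R :=
  \prod_(j < d) window (`|x 0 j - (k 0 j)%:~R * h 0 j| / (2 * h 0 j)).

(* When h has positive entries, the sum below is finitely supported at every x
   because rk_basis h k has compact support. *)
Definition trial_space h (Omega : set 'rV[R]_d) : set ('rV[R]_d -> R) :=
  [set u | exists2 c : 'rV[int]_d -> R,
     forall k, ~ (grid h `&` Omega) (grid_point h k) -> c k = 0 &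
     forall x, u x = \sum_(k \in [set: 'rV[int]_d]) (c k * rk_basis h k x)].

Definition grid_shape (hhat : 'rV[R]_d) : Prop :=
  (forall j, 0 < hhat 0 j) /\ \big[Num.max/0]_(j < d) hhat 0 j = 1.

End reproducing_kernel.

Section quadrature.
Context {R : realType} {d : nat}.
Implicit Types (P : {fset 'rV[R]_d}) (rho : R -> R) (s x : 'rV[R]_d).

Definition flip_coord (j : 'I_d) s : 'rV[R]_d :=
  \row_(i < d) (if i == j then - s 0 i else s 0 i).

Definition symmetric_points P : Prop :=
  [/\ (4 * d <= #|` P|)%N,
      forall s, s \in P -> enorm s <= 1,
      forall s j, s \in P -> flip_coord j s \in P &
      forall s (sigma : {perm 'I_d}), s \in P -> col_perm sigma s \in P].

(* A multi-index is given by its entries, trailing zeros omitted. *)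
Definition discrete_moment P rho (alpha : seq nat) : R :=
  \sum_(s <- P) (\prod_(j < d) s 0 j ^+ nth 0%N alpha j)
                * rho (enorm s) * window (enorm s).

(* For d = 1 the first term vanishes and this is the moment of order 4. *)
Definition weight_denominator P rho : R :=
  d.-1%:R * discrete_moment P rho [:: 2; 2] + discrete_moment P rho [:: 4].

Definition weight P rho s : R :=
  window (enorm s) * enorm s ^+ 2 / weight_denominator P rho.

Definition scaled_weight P rho (delta : R) s : R :=
  delta ^+ d * weight P rho (delta^-1 *: s).

Definition quasi_discrete_op P rho (delta : R) (u : 'rV[R]_d -> R) x : R :=
  2 * \sum_(s <- [fset delta *: s | s in P]%fset)
        scaled_weight P rho delta s * scaled_profile d rho delta (enorm s)
        * (u (x + s) - u x).

Definition collocation_solution P rho h (Omega : set 'rV[R]_d) (delta : R)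
    (f u : 'rV[R]_d -> R) : Prop :=
  trial_space h Omega u /\
  forall x, (grid h `&` Omega) x -> - quasi_discrete_op P rho delta u x = f x.

End quadrature.

(* Main.v *)
Require Import Defs.
From HB Require Import structures.
From mathcomp Require Import all_boot all_order all_fingroup all_algebra finmap.
From mathcomp Require Import all_classical all_reals all_analysis.
From mathcomp Require Import measurable_realfun ring lra zify.

Set Implicit Arguments.
Unset Strict Implicit.
Unset Printing Implicit Defensive.
Import Order.TTheory GRing.Theory Num.Theory.
Import numFieldNormedType.Exports.

Local Open Scope classical_set_scope.
Local Open Scope ring_scope.

(* Consistency.  Cubic B-spline quasi-interpolation reproduces linear functions
   and maps t^2 to t^2 + h^2/3.  Hence on the grid the operator applied to the
   interpolant of u^0 only sees the second differences of u^0: after averaging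
   over the sign symmetries of the quadrature points all odd and mixed terms of
   the Taylor expansion vanish, the h^2/3 cancels in u(x + s) - u(x), and what
   is left is the Laplacian, up to O((h + delta)^4 / delta^2) = O(delta^2).

   Stability.  The cubic B-spline is the autocorrelation of the hat function.
   So for a grid function e with associated tensor hat function v one has
   <e, - L e> = delta^-2 sum_s w(s) |v - v(. + t_s)|^2 in L^2(R^d), with shifts
   t_s independent of delta in grid units.  Since v has compact support, one
   nonzero shift suffices for a Poincare inequality: |v - v(. + 2t)| is at most
   2 |v - v(. + t)|, and after about log2(1/h) doublings v and its translate are
   orthogonal.  Finally |v|^2 >= 3^-d |e|^2.  The L^2 products are used only
   through the positive semidefiniteness of the kernel
   prod_l spline (x_l - y_l), that is, Schur's product theorem. *)

(** * Taylor expansion of coordinate averages *)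

(** The fixed ratio [M0] makes the stability constant uniform. The [q] doublings cost a factor
    [4 ^+ q] of order h^-2, while inverting the prefactor of the operator gains [delta ^+ 2]; with
    [delta = M0 * h] the product stays bounded. The nonzero shift needed for the doublings always
    exists, because the weights are normalised to second moment 1 and hence cannot all vanish away
    from the origin. The extension of u^0 by zero has bounded derivatives up to order 4 on all of
    R^d. Both its samples and the coefficients of the trial function vanish at nodes outside Omega,
    so the coefficient error [e] does too. The residual of [e] is therefore tested only at
    collocation points, and no boundary layer has to be treated. The l^2 bound for [e] costs nothing
    when turned into an L^2 bound: there are O(h^-d) nodes, and each spline support has volume
    O(h^d). The remaining part of the error is the interpolation error, which is bounded pointwise.
    Since all weights are tensor products, averages are taken one axis at a time and only
    one-dimensional Taylor expansions occur. *)

Section axis_taylor.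
Context {R : realType} {d : nat}.
Implicit Types (V W : 'rV[R]_d -> R) (x : 'rV[R]_d) (j : 'I_d).

(** The mean value point lies between 0 and [t], so its power is at most that of [t]. The factor
    1/(n+1) that integration would give is sacrificed, which keeps factorials out of all later
    remainders. *)
Lemma mean_value_power_bound (F dF : R -> R) (B : R) (n : nat) (t : R) :
  (forall s : R, is_derive s (1 : R) F (dF s)) -> F 0 = 0 -> 0 <= B ->
  (forall s : R, `|dF s| <= B * `|s| ^+ n) -> `|F t| <= B * `|t| ^+ n.+1.
Proof.
move=> dF_ F0 B0 dFB.
have cF (A : set R) : {within A, continuous F}.
  apply: continuous_subspaceT => s; apply: differentiable_continuous.
  by apply/derivable1_diffP; have [] := dF_ s.
have key c : `|c| <= `|t| -> `|dF c * t| <= B * `|t| ^+ n.+1.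
  move=> ct; rewrite normrM exprSr mulrA ler_wpM2r //.
  by rewrite (le_trans (dFB c)) // ler_wpM2l // lerXn2r ?nnegrE.
have [t0|t0] := leP 0 t.
  have [c cI /eqP] := MVT_segment t0 (fun s _ => dF_ s) (cF _).
  rewrite F0 !subr0 => /eqP ->; apply: key.
  by move: cI; rewrite in_itv /= => /andP[c0 ct]; rewrite !ger0_norm.
have [c cI /eqP] := MVT_segment (ltW t0) (fun s _ => dF_ s) (cF _).
rewrite F0 !sub0r mulrN eqr_opp => /eqP ->; apply: key.
move: cI; rewrite in_itv /= => /andP[c0 ct].
by rewrite !ler0_norm ?(ltW t0) // lerN2.
Qed.

Lemma is_derive_axis V x j (t : R) :
  derivable V (x + t *: delta_mx 0 j) (delta_mx 0 j) ->
  is_derive t (1 : R) (fun s : R => V (x + s *: delta_mx 0 j))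
    (partial j V (x + t *: delta_mx 0 j)).
Proof.
have E : (fun h : R => h^-1 *: (((fun s : R => V (x + s *: delta_mx 0 j))
             \o shift t) (h *: 1) - V (x + t *: delta_mx 0 j))) =
    (fun h : R => h^-1 *: ((V \o shift (x + t *: delta_mx 0 j))
             (h *: delta_mx 0 j) - V (x + t *: delta_mx 0 j))).
  apply/funext => h /=; congr (_ *: (V _ - _)).
  by rewrite [h *: 1]mulr1 scalerDl addrCA.
move=> dV; split.
  by rewrite /derivable E.
by rewrite /derive E.
Qed.

(** Induction on [n] for all [V]: along the axis, the derivative of the remainder of order [n.+1] of
    [V] is the remainder of order [n] of [partial j V]. *)
Lemma axis_taylor n V j (K : R) : 0 <= K ->
  (forall k x, (k < n)%N ->
     derivable (iter k (partial j) V) x (delta_mx 0 j)) ->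
  (forall x, `|iter n (partial j) V x| <= K) ->
  forall x (z : R),
    `|V (x + z *: delta_mx 0 j)
      - \sum_(k < n) z ^+ k / k`!%:R * iter k (partial j) V x| <= K * `|z| ^+ n.
Proof.
move=> K0; elim: n V => [|n IH] V dV bV x z.
  by rewrite big_ord0 subr0 expr0 mulr1; exact: bV.
pose F (s : R) := V (x + s *: delta_mx 0 j)
      - \sum_(k < n.+1) s ^+ k / k`!%:R * iter k (partial j) V x.
pose dF (s : R) := partial j V (x + s *: delta_mx 0 j)
      - \sum_(k < n) s ^+ k / k`!%:R * iter k (partial j) (partial j V) x.
apply: (@mean_value_power_bound F dF) => //.
- move=> s; apply: is_deriveB.
    by apply: is_derive_axis; exact: (dV 0%N).
  rewrite (_ : (fun s : R => _) = (fun s : R =>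
    V x + \sum_(k < n) s ^+ k.+1 / k.+1`!%:R
          * iter k (partial j) (partial j V) x)); last first.
    apply/funext => r; rewrite big_ord_recl /= fact0 divr1 mul1r.
    by congr (_ + _); apply: eq_bigr => k _; rewrite -iterSr.
  rewrite -[X in is_derive _ _ _ X]add0r; apply: is_deriveD.
  rewrite (_ : (fun s : R => _) = \sum_(k < n) (fun s : R =>
      s ^+ k.+1 / k.+1`!%:R * iter k (partial j) (partial j V) x)); last first.
    by apply/funext => r; rewrite fct_sumE.
  apply: is_derive_sum => k.
  have fE : (fun r : R => r ^+ k.+1 / k.+1`!%:R
      * iter k (partial j) (partial j V) x) =
      ((k.+1`!%:R)^-1 * iter k (partial j) (partial j V) x) *:
      ((id : R -> R) ^+ k.+1).
    by apply/funext => r /=; rewrite exprfctE /= [RHS]mulrC mulrA.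
  rewrite fE; apply: is_derive_eq.
  rewrite /= factS natrM invfM /GRing.scale /= mulr1 -mulr_natl.
  have kn0 : k.+1%:R != 0 :> R by rewrite pnatr_eq0.
  have fn0 : k`!%:R != 0 :> R by rewrite pnatr_eq0 -lt0n fact_gt0.
  by field; rewrite fn0 /= addrC natr1 kn0.
- rewrite /F scale0r addr0 big_ord_recl /= expr0 fact0 divr1 mul1r.
  by rewrite big1 ?addr0 ?subrr // => k _; rewrite expr0n /= !mul0r.
move=> s; apply: IH => [k y kn|y].
  by rewrite -iterSr; exact: dV.
by rewrite -iterSr; exact: bV.
Qed.

End axis_taylor.

Section smooth_functions.
Context {R : realType} {d : nat}.

Definition smooth_bounded (n : nat) (K : R) (V : 'rV[R]_d -> R) : Prop :=
  forall js : seq 'I_d, (size js <= n)%N ->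
    ((size js < n)%N -> forall (j : 'I_d) x,
        derivable (iter_partial js V) x (delta_mx 0 j)) /\
    forall x, `|iter_partial js V x| <= K.

Lemma smooth_bounded_ge0 n K V : smooth_bounded n K V -> 0 <= K.
Proof. by move=> /(_ [::] isT)[_ /(_ 0)]; exact: le_trans. Qed.

Lemma smooth_bounded_le m n K V :
  (m <= n)%N -> smooth_bounded n K V -> smooth_bounded m K V.
Proof.
move=> mn sV js jm; have [dV bV] := sV js (leq_trans jm mn).
by split => // jm'; apply: dV; exact: leq_trans jm' mn.
Qed.

Lemma smooth_bounded_partial2 K V j :
  smooth_bounded 4 K V -> smooth_bounded 2 K (partial j (partial j V)).
Proof.
move=> sV js js2.
have E : iter_partial js (partial j (partial j V)) =
  iter_partial (js ++ [:: j; j]) V by rewrite /iter_partial foldr_cat.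
have sz : size (js ++ [:: j; j]) = (size js).+2 by rewrite size_cat addn2.
have [|dV bV] := sV (js ++ [:: j; j]); first by rewrite sz.
by rewrite E; split => // js2' i x; apply: dV; rewrite sz.
Qed.

Lemma smooth_bounded_taylor n K V : smooth_bounded n K V ->
  forall j x (z : R), `|V (x + z *: delta_mx 0 j)
      - \sum_(k < n) z ^+ k / k`!%:R * iter k (partial j) V x| <= K * `|z| ^+ n.
Proof.
move=> sV j; have E k : iter k (partial j) V = iter_partial (nseq k j) V.
  by elim: k => //= k ->.
apply: axis_taylor; first exact: smooth_bounded_ge0 sV.
  move=> k x kn; rewrite E.
  by have [|dV _] := sV (nseq k j); rewrite ?size_nseq ?(ltnW kn)//;
    apply: dV; rewrite size_nseq.
by move=> x; rewrite E; have [|_] := sV (nseq n j); rewrite ?size_nseq.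
Qed.

End smooth_functions.

Section coordinate_averages.
Context {R : realType} {d : nat} {T : finType}.
Variables (a z : 'I_d -> T -> R).
Implicit Types (V W : 'rV[R]_d -> R) (x : 'rV[R]_d) (j : 'I_d).

Definition avg j V x : R := \sum_n a j n * V (x + z j n *: delta_mx 0 j).

Definition avgs V (js : seq 'I_d) : 'rV[R]_d -> R := foldr avg V js.

Hypothesis a_ge0 : forall j n, 0 <= a j n.
Hypothesis a_sum1 : forall j, \sum_n a j n = 1.

Lemma avg_norm j V x (B : R) : (forall y, `|V y| <= B) -> `|avg j V x| <= B.
Proof.
move=> VB; rewrite -[leRHS]mul1r -(a_sum1 j) mulr_suml.
apply: le_trans (ler_norm_sum _ _ _) _; apply: ler_sum => n _.
by rewrite normrM (ger0_norm (a_ge0 j n)) ler_wpM2l.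
Qed.

Section product_form.
Let ffset (p : T * {ffun 'I_d -> T}) j : T * {ffun 'I_d -> T} :=
  (p.2 j, [ffun i => if i == j then p.1 else p.2 i]).

Let ffsetK j : involutive (ffset^~ j).
Proof.
move=> [n i]; rewrite /ffset /= ffunE eqxx; congr pair.
by apply/ffunP => l; rewrite !ffunE; case: eqP => // ->.
Qed.

(** The involution [ffset] exchanges the separate entry with coordinate [j]. As [f] ignores that
    coordinate of its second argument, the entry moved out carries only its weight and sums to 1. *)
Let split_coordinate j (f : T -> {ffun 'I_d -> T} -> R) :
  (forall n (i : {ffun 'I_d -> T}) n', f n [ffun l =>
    if l == j then n' else i l] = f n i) ->
  \sum_(i : {ffun 'I_d -> T}) (\prod_l a l (i l)) * f (i j) i =
  \sum_n a j n * \sum_(i : {ffun 'I_d -> T}) (\prod_l a l (i l)) * f n i.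
Proof.
move=> fj; under [RHS]eq_bigr do rewrite big_distrr /=.
rewrite pair_big /= (reindex_inj (inv_inj (ffsetK j))) /=.
rewrite -(pair_big xpredT xpredT (fun (n : T) (i : {ffun 'I_d -> T}) =>
  a j (i j) * ((\prod_l a l ((ffset (n, i) j).2 l)) *
     f (i j) (ffset (n, i) j).2))) /= exchange_big /=.
apply: eq_bigr => i _; transitivity
  (\sum_n a j n * ((\prod_l a l (i l)) * f (i j) i)).
  by rewrite -mulr_suml a_sum1 mul1r.
apply: eq_bigr => n _; rewrite fj 2!mulrA; congr (_ * _).
rewrite (bigD1 j) //= [in RHS](bigD1 j) //= ffunE eqxx mulrCA.
congr (_ * (_ * _)); apply: eq_bigr => l lj.
by rewrite ffunE (negbTE lj).
Qed.

Lemma avgs_sum V (js : seq 'I_d) x : uniq js ->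
  avgs V js x = \sum_(i : {ffun 'I_d -> T}) (\prod_j a j (i j)) *
     V (x + \sum_(j <- js) z j (i j) *: delta_mx 0 j).
Proof.
elim: js x => [|j js IH] x /=.
  move=> _; under eq_bigr do rewrite big_nil addr0.
  rewrite -mulr_suml -(bigA_distr_bigA a) big1 ?mul1r //.
move=> /andP[jjs ujs]; rewrite /avg.
pose f (n : T) (i : {ffun 'I_d -> T}) :=
  V (x + z j n *: delta_mx 0 j + \sum_(l <- js) z l (i l) *: delta_mx 0 l).
transitivity (\sum_(i : {ffun 'I_d -> T}) (\prod_l a l (i l)) * f (i j) i).
  rewrite split_coordinate; first by apply: eq_bigr => n _; rewrite IH.
  move=> n i n'; congr V; congr (_ + _); apply: eq_big_seq => l ljs.
  by rewrite ffunE; case: eqP => // lj; rewrite lj (negbTE jjs) in ljs.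
by apply: eq_bigr => i _; rewrite /f big_cons addrA.
Qed.

Lemma avgs_enum_sum V x :
  avgs V (enum 'I_d) x = \sum_(i : {ffun 'I_d -> T}) (\prod_j a j (i j)) *
     V (\row_j (x 0 j + z j (i j))).
Proof.
rewrite avgs_sum ?enum_uniq //; apply: eq_bigr => i _; congr (_ * V _).
apply/rowP => l; rewrite !mxE big_enum /= summxE (bigD1 l) //= !mxE !eqxx mulr1.
by rewrite big1 ?addr0 // => j jl; rewrite !mxE eq_sym (negbTE jl) mulr0.
Qed.

End product_form.

Variables (Z : R) (q : 'I_d -> R).
Hypothesis z_le : forall j n, a j n != 0 -> `|z j n| <= Z.
Hypothesis Z_ge0 : 0 <= Z.
Hypothesis moment1 : forall j, \sum_n a j n * z j n = 0.

Lemma avg_taylor n K V j x : smooth_bounded n K V ->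
  `|avg j V x - \sum_(k < n) (\sum_m a j m * z j m ^+ k) / k`!%:R
      * iter k (partial j) V x| <= K * Z ^+ n.
Proof.
move=> sV; have K0 := smooth_bounded_ge0 sV.
have -> : \sum_(k < n) (\sum_m a j m * z j m ^+ k) / k`!%:R
      * iter k (partial j) V x = \sum_m a j m *
      \sum_(k < n) z j m ^+ k / k`!%:R * iter k (partial j) V x.
  under [RHS]eq_bigr do rewrite mulr_sumr.
  rewrite [RHS]exchange_big /=; apply: eq_bigr => k _.
  by rewrite !mulr_suml; apply: eq_bigr => m _; rewrite !mulrA.
have -> : K * Z ^+ n = \sum_m a j m * (K * Z ^+ n).
  by rewrite -mulr_suml a_sum1 mul1r.
rewrite -sumrB.
apply: le_trans (ler_norm_sum _ _ _) _; apply: ler_sum => m _.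
rewrite -mulrBr normrM (ger0_norm (a_ge0 j m)).
(* Offsets are bounded only where the weight is nonzero: the spline weights range over a whole box
   of nodes, but only those close to the point count. *)
have [->|am0] := eqVneq (a j m) 0; first by rewrite !mul0r.
rewrite ler_wpM2l // (le_trans (smooth_bounded_taylor sV _ _ _)) //.
by rewrite ler_wpM2l // lerXn2r ?nnegrE // z_le.
Qed.

Lemma avg_order2 K V j x : smooth_bounded 2 K V ->
  `|avg j V x - V x| <= K * Z ^+ 2.
Proof.
move=> /(avg_taylor j x); rewrite !big_ord_recr big_ord0 /=.
under eq_bigr do rewrite expr0 mulr1.
under [in X in _ - (_ + _ + X)]eq_bigr do rewrite expr1.
by rewrite a_sum1 moment1 !mul0r addr0 add0r fact0 divr1 mul1r.
Qed.

Lemma avgsB V W j x :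
  avg j (fun y => V y - W y) x = avg j V x - avg j W x.
Proof. by rewrite /avg -sumrB; apply: eq_bigr => n _; rewrite mulrBr. Qed.

Lemma avgs_order2 K V js x : smooth_bounded 2 K V ->
  `|avgs V js x - V x| <= (size js)%:R * (K * Z ^+ 2).
Proof.
move=> sV; elim: js x => [|j js IH] x /=.
  by rewrite subrr normr0 mul0r.
rewrite (_ : _ - _ = avg j (fun y => avgs V js y - V y) x + (avg j V x - V x)).
  rewrite -natr1 mulrDl mul1r (le_trans (ler_normD _ _)) // lerD //.
    exact: avg_norm.
  exact: avg_order2.
by rewrite avgsB addrA subrK.
Qed.

Hypothesis moment2 : forall j, \sum_n a j n * z j n ^+ 2 = 2 * q j.
Hypothesis moment3 : forall j, \sum_n a j n * z j n ^+ 3 = 0.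

Lemma avg_order4 K V j x : smooth_bounded 4 K V ->
  `|avg j V x - V x - q j * partial j (partial j V) x| <= K * Z ^+ 4.
Proof.
move=> /(avg_taylor j x); rewrite !big_ord_recr big_ord0 /=.
under eq_bigr do rewrite expr0 mulr1.
under [in X in _ - (_ + _ + X + _ + _)]eq_bigr do rewrite expr1.
rewrite a_sum1 moment1 moment2 moment3 !mul0r !addr0 add0r fact0 divr1 mul1r.
by rewrite opprD addrA [2 * _]mulrC mulfK ?pnatr_eq0.
Qed.

Lemma half_moment2_bound j : 0 <= q j <= Z ^+ 2.
Proof.
have := moment2 j => E.
have q0 : 0 <= 2 * q j.
  by rewrite -E sumr_ge0 // => n _; rewrite mulr_ge0 // sqr_ge0.
have : 2 * q j <= Z ^+ 2.
  rewrite -E -[leRHS]mul1r -(a_sum1 j) mulr_suml ler_sum // => n _.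
  have [->|an0] := eqVneq (a j n) 0; first by rewrite !mul0r.
  rewrite ler_wpM2l // -[z j n ^+ 2]ger0_norm ?sqr_ge0 // normrX.
  by rewrite lerXn2r ?nnegrE // z_le.
by move: q0; lra.
Qed.

Lemma avgs_order4 K V js x : smooth_bounded 4 K V ->
  `|avgs V js x - V x - \sum_(j <- js) q j * partial j (partial j V) x|
     <= (size js)%:R ^+ 2 * (K * Z ^+ 4).
Proof.
move=> sV; have K0 := smooth_bounded_ge0 sV.
elim: js x => [|j js IH] x /=.
  by rewrite big_nil !subr0 subrr normr0 expr0n mul0r.
pose D i := partial i (partial i V).
pose S y := \sum_(i <- js) q i * D i y.
(* Averaging along [j] also moves the second-order terms already collected. That last error is of
   order 2 in each [D i], and [q i <= Z ^+ 2] lifts it to order 4. With n the size of [js], the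
   three errors total n^2 + 1 + n <= (n + 1)^2 units. *)
have -> : avg j (avgs V js) x - V x - \sum_(i <- j :: js) q i * D i x =
  avg j (fun y => avgs V js y - V y - S y) x
  + (avg j V x - V x - q j * D j x)
  + \sum_(i <- js) q i * (avg j (D i) x - D i x).
  rewrite big_cons.
  have -> : \sum_(i <- js) q i * (avg j (D i) x - D i x) = avg j S x - S x.
    rewrite /S /avg; under [in RHS]eq_bigr do rewrite mulr_sumr.
    rewrite [in RHS]exchange_big -sumrB /=; apply: eq_bigr => i _.
    rewrite mulrBr mulr_sumr; congr (_ - _); apply: eq_bigr => n _.
    by rewrite mulrCA.
  rewrite (avgsB (fun y => avgs V js y - V y) S) avgsB /S; ring.
set n := size js; pose E := K * Z ^+ 4.
have E0 : 0 <= E by rewrite mulr_ge0 // exprn_ge0.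
apply: (@le_trans _ _ (n%:R ^+ 2 * E + E + n%:R * E)); last first.
  rewrite -natr1; have n0 : 0 <= n%:R :> R by rewrite ler0n.
  by rewrite -/E; nra.
rewrite (le_trans (ler_normD _ _)) // lerD //.
  rewrite (le_trans (ler_normD _ _)) // lerD //; first exact: avg_norm.
  exact: avg_order4.
rewrite (le_trans (ler_norm_sum _ _ _)) //.
have -> : n%:R * E = \sum_(i <- js) E.
  by rewrite big_const_seq count_predT iter_addr_0 mulr_natl.
rewrite ler_sum // => i _.
have /andP[q0 qZ] := half_moment2_bound i.
rewrite normrM (ger0_norm q0) /E (_ : K * Z ^+ 4 = Z ^+ 2 * (K * Z ^+ 2));
  last by ring.
by rewrite ler_pM //; apply/avg_order2/smooth_bounded_partial2.
Qed.

End coordinate_averages.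

(** * The cubic B-spline *)

Section cubic_spline.
Context {R : realType}.
Implicit Types (x y t r : R).

(* The cubic B-spline; [window] is half as wide. *)
Definition spline y : R := window (`|y| / 2).

Lemma spline_inner y : `|y| <= 1 ->
  spline y = 2 / 3 - y ^+ 2 + `|y| ^+ 3 / 2.
Proof.
move=> y1; rewrite /spline /window ifT; last by lra.
by rewrite -[y ^+ 2]real_normK ?num_real //; field.
Qed.

Lemma spline_outer y : 1 <= `|y| -> `|y| <= 2 -> spline y = (2 - `|y|) ^+ 3 / 6.
Proof.
move=> y1 y2; rewrite /spline /window (@ifT _ (`|y| / 2 <= 1)); last by lra.
case: ifPn => [yh|_]; last by field.
have -> : `|y| = 1 by apply/eqP; rewrite eq_le y1 andbT; lra.
by field.
Qed.

Lemma spline_out y : 2 <= `|y| -> spline y = 0.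
Proof.
rewrite le_eqVlt => /orP[/eqP y2|y2].
  by rewrite spline_outer -y2 ?subrr ?expr0n ?mul0r //; lra.
by rewrite /spline /window ifF ?ifF //; apply/negbTE; rewrite -ltNge; lra.
Qed.

Lemma splineN y : spline (- y) = spline y.
Proof. by rewrite /spline normrN. Qed.

Lemma spline_ge0 y : 0 <= spline y.
Proof.
have [y2|y2] := lerP 2 `|y|; first by rewrite spline_out.
have [y1|y1] := lerP `|y| 1.
  rewrite spline_inner // -[y ^+ 2]real_normK ?num_real //.
  have := normr_ge0 y; set a := `|y| in y1 y2 *; nra.
by rewrite spline_outer ?(ltW y1) ?(ltW y2) // divr_ge0 // exprn_ge0 //
  subr_ge0 ltW.
Qed.

Lemma spline_neq0 y : spline y != 0 -> `|y| < 2.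
Proof. by apply: contraNT; rewrite -leNgt => /spline_out ->. Qed.

Lemma spline_le1 y : spline y <= 1.
Proof.
have [y2|y2] := lerP 2 `|y|; first by rewrite spline_out.
have [y1|y1] := lerP `|y| 1.
  rewrite spline_inner // -[y ^+ 2]real_normK ?num_real //.
  have := normr_ge0 y; set a := `|y| in y1 y2 *; nra.
rewrite spline_outer ?(ltW y1) ?(ltW y2) // ler_pdivrMr // mul1r.
set a := `|y| in y1 y2 *; have a1 : 0 <= 2 - a <= 1 by lra.
have : (2 - a) ^+ 3 <= 1 by rewrite exprn_ile1 //; lra.
lra.
Qed.

Lemma sum_four (M p : nat) (F : nat -> R) : (p + 4 <= M)%N ->
  (forall i, (i < p)%N || (p + 4 <= i)%N -> F i = 0) ->
  \sum_(i < M) F i = F p + F p.+1 + F p.+2 + F p.+3.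
Proof.
move=> pM F0; rewrite -(big_mkord xpredT F) (@big_cat_nat _ _ _ p) //=;
  last by lia.
rewrite big_nat big1 ?add0r => [|i ip]; last by apply: F0; lia.
rewrite (@big_cat_nat _ _ _ (p + 4)) //=; last by lia.
rewrite [X in _ + X]big_nat [X in _ + X]big1 ?addr0 => [|i ip]; last first.
  by apply: F0; lia.
by rewrite -[X in index_iota X](add0n p) big_addn addKn big_mkord
  !big_ord_recl big_ord0 /= !addr0 !addrA.
Qed.

(** At most four integer translates are nonzero at [y], starting from the integer floor(y) - 1, and
    [r] is the fractional part of [y]. The margin 2 keeps all four inside the index range. *)
Lemma spline_sum (N : nat) y (g : R -> R) : `|y| <= N%:R - 2 ->
  exists2 r, 0 <= r < 1 &
    \sum_(i < N.*2.+1) spline (y - (i%:R - N%:R)) * g (i%:R - N%:R - y) =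
    spline (r + 1) * g (- r - 1) + spline r * g (- r)
    + spline (r - 1) * g (1 - r) + spline (r - 2) * g (2 - r).
Proof.
rewrite ler_norml => /andP[yl yu].
have y0 : 0 <= y + N%:R - 1 by lra.
have /andP[] := truncn_itv y0; set p := Num.truncn _ => pl pu.
pose r := y + N%:R - 1 - p%:R; rewrite -natr1 in pu.
have pM : (p + 4 <= N.*2.+1)%N.
  rewrite addn4 ltnS -(ler_nat R) -addnn natrD -addn3 natrD; lra.
exists r; first by rewrite /r; lra.
rewrite (@sum_four _ p (fun i =>
  spline (y - (i%:R - N%:R)) * g (i%:R - N%:R - y))) //.
  by rewrite -!natr1; congr (spline _ * g _ + spline _ * g _
    + spline _ * g _ + spline _ * g _); rewrite /r; lra.
move=> i /orP[ip|pi].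
  have {}ip : i%:R + 1 <= p%:R :> R by rewrite natr1 ler_nat.
  by rewrite spline_out ?mul0r // ger0_norm; lra.
have {}pi : p%:R + 4 <= i%:R :> R by rewrite -natrD ler_nat.
by rewrite spline_out ?mul0r // ler0_norm; lra.
Qed.

Lemma spline_pieces r : 0 <= r < 1 ->
  [/\ spline (r + 1) = (1 - r) ^+ 3 / 6,
      spline r = 2 / 3 - r ^+ 2 + r ^+ 3 / 2,
      spline (r - 1) = 2 / 3 - (1 - r) ^+ 2 + (1 - r) ^+ 3 / 2 &
      spline (r - 2) = r ^+ 3 / 6].
Proof.
move=> /andP[r0 r1].
have E1 : `|r + 1| = r + 1 by rewrite ger0_norm; lra.
have E2 : `|r| = r by rewrite ger0_norm.
have E3 : `|r - 1| = 1 - r by rewrite ler0_norm; lra.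
have E4 : `|r - 2| = 2 - r by rewrite ler0_norm; lra.
split.
- by rewrite spline_outer E1; try lra; congr (_ ^+ 3 / _); lra.
- by rewrite spline_inner E2; lra.
- by rewrite spline_inner E3; try lra; field.
- by rewrite spline_outer E4; try lra; congr (_ ^+ 3 / _); lra.
Qed.

(** Moments about the point [y - t]. The odd ones are odd in [t], so they cancel when [t] and [- t]
    are averaged; the second one contains [t] only through [t ^+ 2]. The case [t = 0] gives the
    partition of unity and linear reproduction. *)
Lemma spline_moments (N : nat) y t : `|y| <= N%:R - 2 ->
  [/\ \sum_(i < N.*2.+1) spline (y - (i%:R - N%:R)) = 1,
      \sum_(i < N.*2.+1) spline (y - (i%:R - N%:R)) * (i%:R - N%:R - y + t) = t,
      \sum_(i < N.*2.+1) spline (y - (i%:R - N%:R)) * (i%:R - N%:R - y + t) ^+ 2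
        = t ^+ 2 + 1 / 3 &
      \sum_(i < N.*2.+1) spline (y - (i%:R - N%:R)) * (i%:R - N%:R - y + t) ^+ 3
        = t ^+ 3 + t].
Proof.
move=> yN; split.
- have [r r01] := spline_sum (fun=> 1) yN.
  under eq_bigr do rewrite mulr1.
  by move=> ->; have [-> -> -> ->] := spline_pieces r01; field.
- have [r r01 ->] := spline_sum (fun u => u + t) yN.
  by have [-> -> -> ->] := spline_pieces r01; field.
- have [r r01 ->] := spline_sum (fun u => (u + t) ^+ 2) yN.
  by have [-> -> -> ->] := spline_pieces r01; field.
- have [r r01 ->] := spline_sum (fun u => (u + t) ^+ 3) yN.
  by have [-> -> -> ->] := spline_pieces r01; field.
Qed.

End cubic_spline.

(** * Positive semidefiniteness and the Poincare inequality *)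

Section positive_semidefinite.
Context {R : realType} {I : finType}.
Implicit Types (K : I -> I -> R) (c : I -> R).

Definition psd K : Prop := forall c, 0 <= \sum_i \sum_j c i * c j * K i j.

Lemma eq_psd K1 K2 : (forall i j, K1 i j = K2 i j) -> psd K1 -> psd K2.
Proof.
move=> E P c; have := P c; congr (_ <= _).
by apply: eq_bigr => i _; apply: eq_bigr => j _; rewrite E.
Qed.

Lemma psd1 : psd (fun _ _ => 1).
Proof.
move=> c; have -> : \sum_i \sum_j c i * c j * 1 = (\sum_i c i) ^+ 2.
  rewrite expr2 mulr_suml; apply: eq_bigr => i _; rewrite mulr_sumr.
  by apply: eq_bigr => j _; rewrite mulr1.
exact: sqr_ge0.
Qed.

Lemma psdD K1 K2 : psd K1 -> psd K2 -> psd (fun i j => K1 i j + K2 i j).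
Proof.
move=> P1 P2 c; have := addr_ge0 (P1 c) (P2 c); congr (_ <= _).
rewrite -big_split; apply: eq_bigr => i _; rewrite -big_split.
by apply: eq_bigr => j _; rewrite mulrDr.
Qed.

Lemma psdZ (r : R) K : 0 <= r -> psd K -> psd (fun i j => r * K i j).
Proof.
move=> r0 P c; have := mulr_ge0 r0 (P c); congr (_ <= _).
rewrite mulr_sumr; apply: eq_bigr => i _; rewrite mulr_sumr.
by apply: eq_bigr => j _; rewrite mulrCA.
Qed.

Lemma psd_rank1 (f : I -> R) K : psd K -> psd (fun i j => f i * f j * K i j).
Proof.
move=> P c; have := P (fun i => c i * f i); congr (_ <= _).
by apply: eq_bigr => i _; apply: eq_bigr => j _; rewrite mulrACA !mulrA.
Qed.

Lemma psd_sum (J : finType) (K : J -> I -> I -> R) :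
  (forall z, psd (K z)) -> psd (fun i j => \sum_z K z i j).
Proof.
move=> P; elim: (index_enum J) => [|z s IH].
  apply: (@eq_psd (fun i j => 0 * 1)) => [i j|]; first by rewrite big_nil mul0r.
  exact: psdZ psd1.
apply: (@eq_psd (fun i j => K z i j + \sum_(z <- s) K z i j)) => [i j|].
  by rewrite big_cons.
exact: psdD.
Qed.

Lemma sum_delta (M a b : nat) : (a <= M)%N ->
  \sum_(z < M.+1) (a == z)%:R * (b == z)%:R = (a == b)%:R :> R.
Proof.
move=> aM; rewrite (bigD1 (Ordinal (aM : (a < M.+1)%N))) //= eqxx mul1r eq_sym.
rewrite big1 ?addr0 // => z; rewrite -val_eqE /= eq_sym => /negbTE ->.
by rewrite mul0r.
Qed.

(** The equality kernel is the sum, over the levels [z], of the rank-one kernels of the indicators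
    of [n i == z]; the bound [M] makes this a finite sum. *)
Lemma psd_delta (n : I -> nat) (M : nat) K : (forall i, (n i <= M)%N) ->
  psd K -> psd (fun i j => (n i == n j)%:R * K i j).
Proof.
move=> nM P; apply: (@eq_psd (fun i j => \sum_(z < M.+1)
    (n i == z)%:R * (n j == z)%:R * K i j)) => [i j|].
  by rewrite -mulr_suml sum_delta.
by apply: psd_sum => z; exact: (psd_rank1 (fun i => (n i == z)%:R)).
Qed.

(** The values 2/3, 1/6, 0 are arranged so that the second bracket is the Gram sum over [z] of
    products of (a == z) + (a.+1 == z) with the same expression in [b]. What remains is the 1/3 of
    the coercivity bound. *)
Lemma spline_int (a b : nat) : spline (a%:R - b%:R) =
  (1 / 3 * (a == b)%:R + 1 / 6 * ((a == b)%:R + (a.+1 == b)%:R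
    + (a == b.+1)%:R + (a == b)%:R) : R).
Proof.
wlog ab : a b / (a <= b)%N => [H|].
  have [|ba] := leqP a b; first exact: H.
  rewrite -splineN opprB (H b a) ?(ltnW ba) // ![b == a]eq_sym ![b.+1 ==
    a]eq_sym.
  by rewrite [b == a.+1]eq_sym; ring.
have -> : b = (a + (b - a))%N by lia.
set k := (b - a)%N; rewrite natrD opprD addrA subrr sub0r splineN.
have -> : (a == (a + k).+1) = false by lia.
have -> : (a == (a + k)%N) = (k == 0%N) by lia.
have -> : (a.+1 == (a + k)%N) = (k == 1%N) by lia.
case: k => [|[|k]] /=.
- by rewrite spline_inner normr0 ?ler01 //; field.
- by rewrite spline_inner normr1 //; field.
- by rewrite spline_out ?ger0_norm ?ler0n ?ler_nat //=; ring.
Qed.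

(* The Toeplitz matrix tridiag(1/6, 2/3, 1/6) minus a third of the identity is
   a sum of rank-one matrices. *)
Lemma psd_spline_sub_delta (n : I -> nat) (M : nat) K :
  (forall i, (n i <= M)%N) -> psd K ->
  psd (fun i j => (spline ((n i)%:R - (n j)%:R) - 1 / 3 * (n i == n j)%:R)
                  * K i j).
Proof.
move=> nM P; pose f (z : nat) i : R := (n i == z)%:R + ((n i).+1 == z)%:R.
apply: (@eq_psd (fun i j => 1 / 6 * \sum_(z < M.+2) f z i * f z j * K i j)).
  move=> i j; rewrite -mulr_suml mulrA; congr (_ * _); rewrite spline_int.
  rewrite addrAC subrr add0r; congr (_ * _).
  under eq_bigr do rewrite /f mulrDl !mulrDr.
  have nM1 k : (n k <= M.+1)%N by exact: leqW.
  by rewrite !big_split /= !sum_delta ?ltnS // eqSS; ring.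
apply: psdZ => //; apply: psd_sum => z; exact: psd_rank1.
Qed.

End positive_semidefinite.

(** * The spline kernel as an integral of products of hats, through an explicit primitive *)

Section spline_positive_definite.
Context {R : realType}.
Implicit Types (a b x y z : R).

Definition pos x : R := Num.max x 0.

Lemma pos_ge0E x : 0 <= x -> pos x = x.
Proof. by move=> x0; rewrite /pos max_l. Qed.

Lemma pos_le0E x : x <= 0 -> pos x = 0.
Proof. by move=> x0; rewrite /pos max_r. Qed.

(** Serves for squared truncated powers, which are differentiable at their kink although [pos] is
    not: an explicit quadratic error settles both sides at once. *)
Lemma is_derive_quadratic_bound (F : R -> R) x (l C : R) :
  (forall h, `|F (h + x) - F x - l * h| <= C * h ^+ 2) ->
  is_derive x (1 : R) F l.
Proof.
move=> FC.
have L : (fun h : R => h^-1 *: ((F \o shift x) (h *: (1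
  : R)) - F x)) @ 0^' --> l.
  apply/cvgrPdist_le => e e0.
  have C1 : 0 < `|C| + 1 by rewrite ltr_wpDl.
  near=> h.
  have h0 : h != 0 by near: h; exact: nbhs_dnbhs_neq.
  have hh : h * h^-1 = 1 by rewrite divff.
  have := FC h; rewrite /= [h *: 1]mulr1 -[h^-1 *: _]/(h^-1 * _) => FCh.
  have -> : l - h^-1 * (F (h + x) - F x) = - (h^-1 * (F (h + x) - F x - l * h)).
    by field.
  rewrite normrN normrM normfV ler_pdivrMl ?normr_gt0 //.
  apply: (le_trans FCh); rewrite -real_normK ?num_real // expr2 mulrCA.
  rewrite ler_wpM2l // (le_trans (ler_norm _)) // normrM normr_id.
  have : `|h| <= e / (`|C| + 1).
    near: h; apply: dnbhs0_le; exact: divr_gt0.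
  rewrite ler_pdivlMr // => he; apply: le_trans he.
  by rewrite mulrC ler_wpM2l // lerDl.
by split; [apply/cvg_ex; exists l|apply/cvg_lim].
Unshelve. all: by end_near. Qed.

Lemma is_derive_pos2 a x :
  is_derive x (1 : R) (fun z => pos (z - a) ^+ 2) (2 * pos (x - a)).
Proof.
apply: (@is_derive_quadratic_bound _ _ _ 1) => h.
have -> : h + x - a = h + (x - a) by rewrite addrA.
move: (x - a) => u; rewrite mul1r.
have [u0|u0] := leP 0 u; have [v0|v0] := leP 0 (h + u);
  rewrite ?(pos_ge0E u0) ?(pos_ge0E v0) ?(pos_le0E (ltW u0))
    ?(pos_le0E (ltW v0)) ler_norml; apply/andP; split; nra.
Qed.

Lemma is_derive_pos3 a x :
  is_derive x (1 : R) (fun z => pos (z - a) ^+ 3) (3 * pos (x - a) ^+ 2).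
Proof.
have -> : (fun z => pos (z - a) ^+ 3) =
    (id - cst a) * (fun z => pos (z - a) ^+ 2).
  apply/funext => z /=; rewrite /GRing.mul /= /GRing.add /= /GRing.opp /=.
  have [u0|u0] := leP 0 (z - a); first by rewrite (pos_ge0E u0) exprS.
  by rewrite (pos_le0E (ltW u0)) !expr0n mulr0.
have D2 := is_derive_pos2 a x.
apply: is_derive_eq; rewrite /= /GRing.scale /= subr0 mulr1.
have [u0|u0] := leP 0 (x - a).
  by rewrite (pos_ge0E u0) -[(id - cst a) x]/(x - a); ring.
by rewrite (pos_le0E (ltW u0)); ring.
Qed.

(* An antiderivative of [(z - a)_+ (b - z)_+]. *)
Definition bump_primitive a b z : R :=
  if a <= b then
    (b - a) / 2 * pos (z - a) ^+ 2 + (b - a) / 2 * pos (z - b) ^+ 2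
    + 3^-1 * pos (z - b) ^+ 3 - 3^-1 * pos (z - a) ^+ 3
  else 0.

Lemma is_derive_bump_primitive a b x :
  is_derive x (1 : R) (bump_primitive a b) (pos (x - a) * pos (b - x)).
Proof.
rewrite /bump_primitive; have [ab|ba] := leP a b; last first.
  rewrite (_ : _ * _ = 0); first exact: is_derive_cst.
  have [xa|xa] := leP x a; first by rewrite [pos (x - a)]pos_le0E ?mul0r //;
    lra.
  by rewrite [pos (b - x)]pos_le0E ?mulr0 //; lra.
have Da2 := is_derive_pos2 a x; have Db2 := is_derive_pos2 b x.
have Da3 := is_derive_pos3 a x; have Db3 := is_derive_pos3 b x.
have D := is_deriveB (is_deriveD (is_deriveD (is_deriveZ ((b - a) / 2) Da2)
  (is_deriveZ ((b - a) / 2) Db2)) (is_deriveZ 3^-1 Db3)) (is_deriveZ 3^-1 Da3).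
apply: (is_derive_eq D); rewrite /GRing.scale /=.
have [xa|xa] := leP x a.
  by rewrite [pos (x - a)]pos_le0E ?[pos (x - b)]pos_le0E; try lra; field.
rewrite [pos (x - a)]pos_ge0E; last by lra.
have [xb|xb] := leP x b.
  by rewrite [pos (x - b)]pos_le0E ?[pos (b - x)]pos_ge0E; try lra; field.
by rewrite [pos (x - b)]pos_ge0E ?[pos (b - x)]pos_le0E; try lra; field.
Qed.

(** The area under the parabola with roots [a] and [b]; the interval from [- M] to [M] contains the
    whole bump. *)
Lemma bump_primitive_increment a b M : `|a| <= M -> `|b| <= M ->
  bump_primitive a b M - bump_primitive a b (- M) = pos (b - a) ^+ 3 / 6.
Proof.
rewrite !ler_norml => /andP[? ?] /andP[? ?]; rewrite /bump_primitive.
have [ab|ba] := leP a b; last by rewrite pos_le0E ?subrr ?expr0n ?mul0r //; lra.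
rewrite ![pos (- M - _)]pos_le0E ?pos_ge0E; try lra; by field.
Qed.

(** The classical formula: a fourth central difference of the cubic truncated power over 6. Two
    iterated second differences will produce exactly these coefficients. *)
Lemma spline_truncated_powers y : spline y =
  (pos (y + 2) ^+ 3 - 4 * pos (y + 1) ^+ 3 + 6 * pos y ^+ 3
   - 4 * pos (y - 1) ^+ 3 + pos (y - 2) ^+ 3) / 6.
Proof.
have [y1|y1] := leP y (-2).
  rewrite spline_out; last by rewrite ler0_norm; lra.
  by rewrite !pos_le0E; try lra; field.
have [y2|y2] := leP y (-1).
  rewrite spline_outer ?ler0_norm; try lra.
  by rewrite [pos (y + 2)]pos_ge0E ?pos_le0E; try lra; field.
have [y3|y3] := leP y 0.
  rewrite spline_inner ?ler0_norm; try lra.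
  rewrite [pos (y + 2)]pos_ge0E ?[pos (y + 1)]pos_ge0E ?pos_le0E; try lra;
    by field.
have [y4|y4] := leP y 1.
  rewrite spline_inner ?ger0_norm; try lra.
  rewrite [pos (y - 2)]pos_le0E ?[pos (y - 1)]pos_le0E ?pos_ge0E; try lra;
    by field.
have [y5|y5] := leP y 2.
  rewrite spline_outer ?ger0_norm; try lra.
  by rewrite [pos (y - 2)]pos_le0E ?pos_ge0E; try lra; field.
rewrite spline_out; last by rewrite ger0_norm; lra.
by rewrite !pos_ge0E; try lra; field.
Qed.

Definition hat z : R := pos (z + 1) - 2 * pos z + pos (z - 1).

(** Evenness allows one of the two hats to be expanded in the reflected powers [pos (b - x)].
    Products with [pos (x - a)] are then compactly supported bumps instead of growing functions. *)
Lemma hatN z : hat (- z) = hat z.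
Proof.
wlog z0 : z / 0 <= z => [H|].
  have [|z0] := leP 0 z; first exact: H.
  by rewrite -[in RHS](opprK z) [RHS]H //; lra.
rewrite /hat [pos (- z - 1)]pos_le0E; last by lra.
rewrite [pos (- z)]pos_le0E; last by lra.
rewrite [pos z]pos_ge0E // [pos (z + 1)]pos_ge0E; last by lra.
have [z1|z1] := leP z 1.
  by rewrite [pos (- z + 1)]pos_ge0E ?[pos (z - 1)]pos_le0E; lra.
by rewrite [pos (- z + 1)]pos_le0E ?[pos (z - 1)]pos_ge0E; lra.
Qed.

Definition second_difference (F : R -> R) x : R := F (x - 1) - 2 * F x
  + F (x + 1).

Definition hat_primitive a b z : R :=
  second_difference (fun a' => second_difference (fun b' =>
    bump_primitive a' b' z) b) a.

Lemma is_derive_second_difference (F dF : R -> R -> R) y x :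
  (forall a, is_derive x (1 : R) (F a) (dF a x)) ->
  is_derive x (1 : R) (fun z => second_difference (F^~ z) y)
    (second_difference (dF^~ x) y).
Proof.
move=> D; exact: (is_deriveD (is_deriveB (D (y - 1))
  (is_deriveZ 2 (D y))) (D (y + 1))).
Qed.

Lemma is_derive_hat_primitive a b x :
  is_derive x (1 : R) (hat_primitive a b) (hat (x - a) * hat (x - b)).
Proof.
have := @is_derive_second_difference
  (fun a' z => second_difference (fun b' => bump_primitive a' b' z) b)
  (fun a' z => second_difference (fun b' => pos (z - a') * pos (b' - z)) b) a x.
rewrite (_ : second_difference _ _ = hat (x - a) * hat (x - b)).
  apply=> a'; apply: (@is_derive_second_difference (bump_primitive a')
    (fun b' z => pos (z - a') * pos (b' - z))) => b'.
  exact: is_derive_bump_primitive.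
rewrite -(hatN (x - b)) /second_difference /hat.
have -> : x - (a - 1) = x - a + 1 by ring.
have -> : x - (a + 1) = x - a - 1 by ring.
have -> : b - 1 - x = - (x - b) - 1 by ring.
have -> : b + 1 - x = - (x - b) + 1 by ring.
have -> : b - x = - (x - b) by ring.
by ring.
Qed.

(** Second differences in [a] and in [b] of a function of [b - a] compose to its fourth difference,
    here that of the cubic truncated power over 6. The margin 1 covers the shifted arguments. *)
Lemma hat_primitive_increment a b M : `|a| + 1 <= M -> `|b| + 1 <= M ->
  hat_primitive a b M - hat_primitive a b (- M) = spline (a - b).
Proof.
move=> aM bM.
have nD x : `|x| + 1 <= M -> [/\ `|x - 1| <= M, `|x| <= M & `|x + 1| <= M].
  rewrite -lerBrDr !ler_norml => /andP[? ?]; split; lra.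
have [a1 a2 a3] := nD _ aM; have [b1 b2 b3] := nD _ bM.
rewrite -splineN opprB spline_truncated_powers.
have E a' b' : `|a'| <= M -> `|b'| <= M -> bump_primitive a' b' M =
    bump_primitive a' b' (- M) + pos (b' - a') ^+ 3 / 6.
  by move=> ? ?; rewrite -(bump_primitive_increment (M := M)) // subrKC.
rewrite /hat_primitive /second_difference !E //.
have -> : b - 1 - (a - 1) = b - a by ring.
have -> : b - (a - 1) = b - a + 1 by ring.
have -> : b + 1 - (a - 1) = b - a + 2 by ring.
have -> : b - 1 - a = b - a - 1 by ring.
have -> : b + 1 - a = b - a + 1 by ring.
have -> : b - 1 - (a + 1) = b - a - 2 by ring.
have -> : b - (a + 1) = b - a - 1 by ring.
have -> : b + 1 - (a + 1) = b - a by ring.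
by field.
Qed.

Lemma is_derive_bigsum (I : Type) (r : seq I) (F : I -> R -> R) (dF
  : I -> R) x :
  (forall i, is_derive x (1 : R) (F i) (dF i)) ->
  is_derive x (1 : R) (fun z => \sum_(i <- r) F i z) (\sum_(i <- r) dF i).
Proof.
move=> D; elim: r => [|i r IH].
  rewrite big_nil (_ : (fun z => _) = cst 0); first exact: is_derive_cst.
  by apply/funext => z; rewrite big_nil.
rewrite big_cons (_ : (fun z => _) = F i + (fun z => \sum_(i <- r) F i z)).
  exact: is_deriveD.
by apply/funext => z; rewrite big_cons.
Qed.

(* Schur's product theorem for the cubic B-spline kernel, which is the Gram
   kernel [int hat (z - x) hat (z - y) dz] of the translated hat functions. *)
Lemma psd_spline (I : finType) (x : I -> R) (K : I -> I -> R) :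
  psd K -> psd (fun i j => spline (x i - x j) * K i j).
Proof.
move=> P c; pose M := \sum_i `|x i| + 1.
have xM i : `|x i| + 1 <= M.
  by rewrite /M lerD2r (bigD1 i) //= lerDl sumr_ge0.
(* The quadratic form is G(M) - G(-M), and [g = G'] is the form of [K] at the coefficients
   [c i * hat (z - x i)], hence nonnegative. The mean value theorem takes the place of an
   integral. *)
pose G z := \sum_i \sum_j c i * c j * K i j * hat_primitive (x i) (x j) z.
pose g z := \sum_i \sum_j c i * c j * K i j * (hat (z - x i) * hat (z - x j)).
have dG z : is_derive z (1 : R) G (g z).
  apply: is_derive_bigsum => i; apply: is_derive_bigsum => j.
  exact: is_deriveZ (is_derive_hat_primitive _ _ _).
have g0 z : 0 <= g z.
  have := P (fun i => c i * hat (z - x i)); congr (_ <= _).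
  apply: eq_bigr => i _; apply: eq_bigr => j _; ring.
have M0 : - M <= M.
  by rewrite ge0_cp ?addr_ge0 ?sumr_ge0 // => i _.
have cG (A : set R) : {within A, continuous G}.
  apply: continuous_subspaceT => s; apply: differentiable_continuous.
  by apply/derivable1_diffP; have [] := dG s.
have [y _ E] := MVT_segment M0 (fun s _ => dG s) (cG _).
have : 0 <= G M - G (- M) by rewrite E mulr_ge0 // subr_ge0.
congr (_ <= _); rewrite /G -sumrB; apply: eq_bigr => i _.
rewrite -sumrB; apply: eq_bigr => j _.
by rewrite -mulrBr hat_primitive_increment //; ring.
Qed.

End spline_positive_definite.

(** * Correlations of a combination of hats with its translates *)

Section translated_energy.
Context {R : realType} {d : nat}.

Lemma psd_prod_spline (I : finType) (x : I -> 'I_d -> R) :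
  psd (fun i j => \prod_l spline (x i l - x j l)).
Proof.
elim: (index_enum _) => [|l s IH].
  by apply: eq_psd (@psd1 R I) => i j; rewrite big_nil.
apply: eq_psd (psd_spline (fun i => x i l) IH) => i j; by rewrite big_cons.
Qed.

Variables (I : finType) (c : I -> R) (n : I -> 'I_d -> nat).

(* For [v = sum_i c i * prod_l hat (y l - n i l)] this is the L2 inner product
   of [v] and its translate by [t]. *)
Definition energy (t : 'I_d -> R) : R :=
  \sum_i \sum_j c i * c j * \prod_l spline ((n i l)%:R - (n j l)%:R + t l).

Lemma eq_energy t1 t2 : t1 =1 t2 -> energy t1 = energy t2.
Proof.
move=> E; apply: eq_bigr => i _; apply: eq_bigr => j _; congr (_ * _).
by apply: eq_bigr => l _; rewrite E.
Qed.

Lemma energyN t : energy (fun l => - t l) = energy t.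
Proof.
rewrite /energy exchange_big; apply: eq_bigr => i _; apply: eq_bigr => j _.
rewrite [c j * c i]mulrC; congr (_ * _); apply: eq_bigr => l _.
by rewrite -splineN opprD opprB opprK.
Qed.

(** The squared norm of a combination of translates of [v]: the pairs of a node and a translate form
    a single family of points for [psd_prod_spline]. *)
Lemma energy_psd (L : finType) (w : L -> R) (p : L -> 'I_d -> R) :
  0 <= \sum_l \sum_m w l * w m * energy (fun k => p l k - p m k).
Proof.
pose x (il : I * L) k := (n il.1 k)%:R + p il.2 k.
have := @psd_prod_spline _ x (fun il => c il.1 * w il.2); congr (_ <= _).
rewrite -(pair_big xpredT xpredT (fun i l => \sum_jm
  c i * w l * (c jm.1 * w jm.2) * \prod_k spline (x (i, l) k - x jm k))) /=.
rewrite exchange_big; apply: eq_bigr => l _.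
transitivity (\sum_i \sum_m \sum_j w l * w m * (c i * c j *
    \prod_k spline ((n i k)%:R - (n j k)%:R + (p l k - p m k)))).
  apply: eq_bigr => i _.
  rewrite -(pair_big xpredT xpredT (fun j m =>
    c i * w l * (c j * w m) * \prod_k spline (x (i, l) k - x (j, m) k))) /=.
  rewrite exchange_big; apply: eq_bigr => m _; apply: eq_bigr => j _.
  have -> : \prod_k spline (x (i, l) k - x (j, m) k) =
      \prod_k spline ((n i k)%:R - (n j k)%:R + (p l k - p m k)).
    by apply: eq_bigr => k _; congr spline; rewrite /x /=; ring.
  by ring.
rewrite exchange_big; apply: eq_bigr => m _; rewrite /energy mulr_sumr.
by apply: eq_bigr => i _; rewrite mulr_sumr.
Qed.

(** Cauchy-Schwarz for [v] and its translate, from the weights 1 and -1 in [energy_psd]. *)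
Lemma energy_le0 t : energy t <= energy (fun=> 0).
Proof.
have := energy_psd (fun b : bool => if b then 1 else -1)
  (fun b k => if b then t k else 0).
rewrite !big_bool /=.
rewrite (@eq_energy (fun k => t k - t k) (fun=> 0)) => [|k];
  last by rewrite subrr.
rewrite (@eq_energy (fun k => t k - 0) t) => [|k]; last by rewrite subr0.
rewrite (@eq_energy (fun k => 0 - t k) (fun k => - t k)) => [|k];
  last by rewrite sub0r.
rewrite (@eq_energy (fun k => 0 - 0) (fun=> 0)) => [|k]; last by rewrite subr0.
by rewrite energyN; lra.
Qed.

(* |v - v(. + 2t)| <= 2 |v - v(. + t)| in terms of inner products: the second
   difference of the translates of v by 0, t, 2t has nonnegative norm. *)
Lemma energy_double t :
  energy (fun=> 0) - energy (fun k => 2 * t k)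
    <= 4 * (energy (fun=> 0) - energy t).
Proof.
have := energy_psd (fun l : 'I_3 => if l == 1%N :> nat then - 2 else 1)
  (fun l k => l%:R * t k).
rewrite !big_ord_recl !big_ord0 /=.
have E a b : energy (fun k => a * t k - b * t k) = energy (fun k =>
  (a - b) * t k).
  by apply: eq_energy => k; rewrite mulrBl.
have EN a : energy (fun k => - a * t k) = energy (fun k => a * t k).
  by rewrite -energyN; apply: eq_energy => k; rewrite mulNr opprK.
have E1 : energy (fun k => 1 * t k) = energy t.
  by apply: eq_energy => k; rewrite mul1r.
have E0 : energy (fun k => 0 * t k) = energy (fun=> 0).
  by apply: eq_energy => k; rewrite mul0r.
rewrite !E !subrr !E0 /bump /= !addn0 !add1n !subr0 !sub0r !EN E1.
have -> : 1 - 2 = - 1 :> R by lra.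
have -> : 2 - 1 = 1 :> R by lra.
by rewrite EN E1; lra.
Qed.

Lemma energy_poincare t (q : nat) (W : R) (l : 'I_d) :
  (forall i j, `|(n i l)%:R - (n j l)%:R : R| <= W) ->
  W + 2 <= 2 ^+ q * `|t l| ->
  energy (fun=> 0) <= 4 ^+ q * (energy (fun=> 0) - energy t).
Proof.
move=> nW tW.
have iter_double : energy (fun=> 0) - energy (fun k => 2 ^+ q * t k)
    <= 4 ^+ q * (energy (fun=> 0) - energy t).
  elim: q {tW} => [|q IH].
    have -> : energy (fun k => 2 ^+ 0 * t k) = energy t.
      by apply: eq_energy => k; rewrite expr0 mul1r.
    by rewrite expr0 mul1r.
  have := energy_double (fun k => 2 ^+ q * t k).
  have -> : energy (fun k => 2 * (2 ^+ q * t k)) =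
      energy (fun k => 2 ^+ q.+1 * t k).
    by apply: eq_energy => k; rewrite exprS mulrA.
  by move/le_trans; apply; rewrite exprS -mulrA ler_wpM2l.
(* After [q] doublings the shift along [l] exceeds the spread [W] of the nodes by at least 2, so
   every spline factor in direction [l] vanishes. *)
suff E0 : energy (fun k => 2 ^+ q * t k) = 0 by rewrite E0 subr0 in iter_double.
rewrite /energy big1 // => i _; rewrite big1 // => j _.
rewrite (bigD1 l) //= spline_out ?mul0r ?mulr0 //.
rewrite addrC; apply: le_trans (lerB_normD _ _).
by rewrite normrM ger0_norm ?exprn_ge0 // lerBrDr addrC (le_trans _ tW) //
  lerD2r.
Qed.

Lemma energy_coercive (M : nat) : (forall i l, (n i l <= M)%N) ->
  (forall i j, (forall l, n i l = n j l) -> i = j) ->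
  (1 / 3) ^+ d * \sum_i c i ^+ 2 <= energy (fun=> 0).
Proof.
move=> nM n_inj.
pose K1 s i j : R := \prod_(l <- s) spline ((n i l)%:R - (n j l)%:R).
pose K0 s i j : R := \prod_(l <- s) (1 / 3 * (n i l == n j l)%:R).
have P1 s : psd (K1 s).
  elim: s => [|l s IH]; first by apply: eq_psd (@psd1 R I) => i j;
    rewrite /K1 big_nil.
  by apply: eq_psd (psd_spline (fun i => (n i l)%:R) IH) => i j;
    rewrite /K1 big_cons.
(* The one-dimensional bound is tensorised through AB - ab = (A - a)B + a(B - b), whose two summands
   are both positive semidefinite by Schur products. As [n] separates indices, the full product [K0]
   is diagonal. *)
have P s : psd (fun i j => K1 s i j - K0 s i j).
  elim: s => [|l s IH].
    apply: (@eq_psd _ _ (fun i j => 0 * 1)); last by apply: psdZ => //;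
      exact: psd1.
    by move=> i j; rewrite /K1 /K0 !big_nil subrr mul0r.
  apply: eq_psd (psdD (psd_spline_sub_delta (n := n^~ l) (nM^~ l) (P1 s))
    (@psdZ _ _ (1 / 3) _ _ (psd_delta (n := n^~ l) (nM^~ l) IH))).
    by move=> i j; rewrite /K1 /K0 !big_cons; ring.
  by rewrite divr_ge0.
have := P (index_enum 'I_d) c.
have -> : \sum_i \sum_j c i * c j *
    (K1 (index_enum 'I_d) i j - K0 (index_enum 'I_d) i j) =
    energy (fun=> 0) - (1 / 3) ^+ d * \sum_i c i ^+ 2.
  rewrite /energy mulr_sumr -sumrB; apply: eq_bigr => i _.
  under eq_bigr do rewrite mulrBr.
  rewrite sumrB; congr (_ - _).
    apply: eq_bigr => j _; congr (_ * _).
    by apply: eq_bigr => l _; rewrite addr0.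
  rewrite (bigD1 i) //= [X in _ + X]big1 ?addr0.
    rewrite mulrC -expr2; congr (_ * _); rewrite /K0.
    under eq_bigr do rewrite eqxx mulr1.
    by rewrite big_const iter_mulr_1 cardE size_enum_ord.
  move=> j ji; have [l nl] : exists l, n i l != n j l.
    apply/existsP; rewrite -negb_forall; apply: contra ji => /forallP nij.
    by apply/eqP/esym/n_inj => l; apply/eqP.
  by rewrite /K0 (bigD1 l) //= (negbTE nl) mulr0 mul0r mulr0.
by rewrite subr_ge0.
Qed.

End translated_energy.

(** * Quadrature weights *)

Section quadrature_weights.
Context {R : realType} {d : nat}.
Implicit Types (s x : 'rV[R]_d).

Lemma enorm_ge0 s : 0 <= enorm s.
Proof. exact: sqrtr_ge0. Qed.

Lemma enormZ (a : R) s : 0 <= a -> enorm (a *: s) = a * enorm s.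
Proof.
move=> a0; rewrite /enorm; under eq_bigr do rewrite mxE exprMn.
by rewrite -mulr_sumr sqrtrM ?sqr_ge0 // sqrtr_sqr ger0_norm.
Qed.

Lemma enorm_sqr s : enorm s ^+ 2 = \sum_(j < d) s 0 j ^+ 2.
Proof. by rewrite sqr_sqrtr // sumr_ge0 // => j _; exact: sqr_ge0. Qed.

Lemma coord_le_enorm s j : `|s 0 j| <= enorm s.
Proof.
rewrite -sqrtr_sqr ler_wsqrtr // (bigD1 j) //= lerDl sumr_ge0 // => i _.
exact: sqr_ge0.
Qed.

Lemma enorm_flip j s : enorm (flip_coord j s) = enorm s.
Proof.
congr Num.sqrt; apply: eq_bigr => i _; rewrite mxE.
by case: ifP => // _; rewrite sqrrN.
Qed.

Lemma enorm_col_perm (g : {perm 'I_d}) s : enorm (col_perm g s) = enorm s.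
Proof.
congr Num.sqrt; under eq_bigr do rewrite mxE.
by rewrite [RHS](reindex_inj (@perm_inj _ g)).
Qed.

Lemma flip_coordK j : involutive (@flip_coord R d j).
Proof.
move=> s; apply/rowP => i; rewrite !mxE.
by case: (i == j); rewrite ?opprK.
Qed.

Lemma window_ge0 (t : R) : 0 <= t -> 0 <= window t.
Proof.
move=> t0; have := spline_ge0 (2 * t).
have -> : spline (2 * t) = window t; last by [].
by rewrite /spline ger0_norm; [congr window; lra|lra].
Qed.

Lemma sum_fset_inj (P : {fset 'rV[R]_d}) (g : 'rV[R]_d -> 'rV[R]_d)
    (F : 'rV[R]_d -> R) :
  injective g -> (forall s, s \in P -> g s \in P) ->
  \sum_(s <- P) F (g s) = \sum_(s <- P) F s.
Proof.
move=> gI gP; rewrite -(big_map g xpredT F); apply: perm_big.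
have ugP : uniq (map g P) by rewrite map_inj_uniq // fset_uniq.
have sub : {subset map g P <= P} by move=> _ /mapP[s sP ->]; exact: gP.
have [|_ eqP] := uniq_min_size ugP sub; first by rewrite size_map.
by apply: uniq_perm => //; exact: fset_uniq.
Qed.

Variables (P : {fset 'rV[R]_d}) (rho : R -> R).
Hypothesis d_gt0 : (0 < d)%N.
Hypothesis Psym : symmetric_points P.
Hypothesis rho_ge0 : forall r, 0 < r -> 0 <= rho r.
Hypothesis denom_neq0 : weight_denominator P rho != 0.

Definition kernel_weight s : R := weight P rho s * rho (enorm s).

Let F s : R := rho (enorm s) * window (enorm s).

Lemma kernel_weightE s :
  kernel_weight s = F s * enorm s ^+ 2 / weight_denominator P rho.
Proof. by rewrite /kernel_weight /weight /F; ring. Qed.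

(** The sign of [rho] is known only at positive radii, so at the origin the factor [g] has to
    vanish. *)
Lemma even_weight_ge0 s (g : R) : (enorm s = 0 -> g = 0) -> 0 <= g ->
  0 <= F s * g.
Proof.
move=> g0 gge0; have := enorm_ge0 s; rewrite le_eqVlt => /orP[/eqP s0|s0].
  by rewrite g0 ?mulr0.
by rewrite mulr_ge0 // mulr_ge0 ?rho_ge0 // window_ge0 // ltW.
Qed.

(** Double transitivity of the symmetric group; it identifies all the off-diagonal fourth moments
    with one another. *)
Lemma exists_perm2 (i j i' j' : 'I_d) : i != j -> i' != j' ->
  exists g : {perm 'I_d}, g i = i' /\ g j = j'.
Proof.
move=> ij ij'; pose k := tperm i i' j.
have ki' : k != i' by rewrite -(tpermL i i') (inj_eq perm_inj) eq_sym.
exists (tperm i i' * tperm k j')%g; rewrite !permM tpermL -/k tpermL;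
  split=> //.
by rewrite tpermD // eq_sym.
Qed.

Let moment2 i j := \sum_(s <- P) F s * (s 0 i ^+ 2 * s 0 j ^+ 2).

Let moment2_perm (g : {perm 'I_d}) i j : moment2 (g i) (g j) = moment2 i j.
Proof.
have [_ _ _ permP] := Psym.
rewrite /moment2 -[RHS](@sum_fset_inj P (col_perm g)).
- by apply: eq_bigr => s _; rewrite /F enorm_col_perm !mxE.
- by move=> s t /rowP st; apply/rowP => l; have := st (g^-1 l)%g;
    rewrite !mxE permKV.
- by move=> s sP; exact: permP.
Qed.

Let discrete_moment4 i : discrete_moment P rho [:: 4] = moment2 i i.
Proof.
pose i0 := Ordinal d_gt0.
rewrite -(tpermL i0 i) moment2_perm; apply: eq_bigr => s _.
rewrite -mulrA mulrC; congr (_ * _);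
  rewrite (bigD1 i0) //= -exprD big1 ?mulr1 //.
by move=> [[|l] ld] //= _; rewrite nth_nil expr0.
Qed.

Let discrete_moment22 i j : i != j -> discrete_moment P rho [:: 2;
  2] = moment2 i j.
Proof.
move=> ij; have d1 : (1 < d)%N.
  by case: d i j ij => [|[|e]] // [[|i] Hi] [[|j] Hj].
pose i0 := Ordinal d_gt0; pose i1 := Ordinal d1.
have i01 : i0 != i1 by [].
have [g [<- <-]] := exists_perm2 i01 ij.
rewrite moment2_perm; apply: eq_bigr => s _.
rewrite -mulrA mulrC; congr (_ * _); rewrite (bigD1 i0) //= (bigD1 i1) //=.
rewrite big1 ?mulr1 //.
by move=> [[|[|l]] ld] //= _; rewrite nth_nil expr0.
Qed.

Let weight_denominatorE i : weight_denominator P rho = \sum_j moment2 i j.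
Proof.
rewrite (bigD1 i) //= /weight_denominator (discrete_moment4 i) addrC.
congr (_ + _); rewrite (eq_bigr (fun=> discrete_moment P rho [:: 2; 2])).
  by rewrite sumr_const cardC1 card_ord mulr_natl.
by move=> j ji; rewrite (@discrete_moment22 i j) // eq_sym.
Qed.

(** By permutation invariance the denominator is a row sum of fourth moments, for whichever row [j];
    this row sum is the moment of s_j^2 |s|^2. The value 1 is what gives the Laplacian the
    coefficient 1. *)
Lemma kernel_weight_normalized j :
  \sum_(s <- P) kernel_weight s * s 0 j ^+ 2 = 1.
Proof.
apply: (mulIf denom_neq0); rewrite mul1r mulr_suml {2}(weight_denominatorE j).
rewrite /moment2 exchange_big /=; apply: eq_bigr => s _.
rewrite kernel_weightE enorm_sqr -mulr_sumr -[in RHS]mulr_sumr.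
by field.
Qed.

Lemma weight_denominator_gt0 : 0 < weight_denominator P rho.
Proof.
rewrite lt_neqAle eq_sym denom_neq0 (weight_denominatorE (Ordinal d_gt0)).
apply: sumr_ge0 => j _; apply: sumr_ge0 => s _; apply: even_weight_ge0.
  move=> s0; have := coord_le_enorm s j; rewrite s0 normr_le0 => /eqP ->.
  by rewrite expr0n mulr0.
by rewrite mulr_ge0 // sqr_ge0.
Qed.

Lemma kernel_weight_ge0 s : 0 <= kernel_weight s.
Proof.
rewrite kernel_weightE divr_ge0 ?(ltW weight_denominator_gt0) //.
by apply: even_weight_ge0; [move=> ->; rewrite expr0n|rewrite sqr_ge0].
Qed.

Lemma exists_kernel_weight_gt0 :
  exists s, [/\ s \in P, 0 < kernel_weight s & exists j, s 0 j != 0].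
Proof.
pose j := Ordinal d_gt0.
have [/hasP[s sP /andP[w0 sj]]|/hasPn none] :=
    boolP (has (fun s => (kernel_weight s != 0) && (s 0 j != 0)) P).
  by exists s; split => //;
    [rewrite lt_neqAle eq_sym w0 kernel_weight_ge0|exists j].
have := kernel_weight_normalized j; rewrite big_seq big1 => [|s sP].
  by move/eqP; rewrite eq_sym oner_eq0.
have := none s sP; rewrite negb_and !negbK => /orP[/eqP ->|/eqP ->].
  by rewrite mul0r.
by rewrite expr0n mulr0.
Qed.

Lemma kernel_weight_flip j s : kernel_weight (flip_coord j s) = kernel_weight s.
Proof. by rewrite /kernel_weight /weight enorm_flip. Qed.

(** Each reflection preserves the points and their weights, so the factors may be made even one
    coordinate at a time; [bs J] has this done for the coordinates in [J]. *)
Lemma sum_kernel_weight_even (b : 'I_d -> R -> R) :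
  \sum_(s <- P) kernel_weight s * \prod_l b l (s 0 l) =
  \sum_(s <- P) kernel_weight s * \prod_l ((b l (s 0 l) + b l (- s 0 l)) / 2).
Proof.
have [_ _ flipP _] := Psym.
pose bs (J : seq 'I_d) l (r : R) :=
  if l \in J then (b l r + b l (- r)) / 2 else b l r.
suff H J : uniq J -> \sum_(s <- P) kernel_weight s * \prod_l b l (s 0 l) =
    \sum_(s <- P) kernel_weight s * \prod_l bs J l (s 0 l).
  rewrite (H (enum 'I_d)) ?enum_uniq //; apply: eq_bigr => s _; congr (_ * _).
  by apply: eq_bigr => l _; rewrite /bs mem_enum.
elim: J => [_|j J IH /andP[jJ /IH ->]].
  by apply: eq_bigr => s _; congr (_ * _); apply: eq_bigr.
pose Q s := kernel_weight s * \prod_l bs J l (s 0 l).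
transitivity (\sum_(s <- P) (Q s + Q (flip_coord j s)) / 2).
  rewrite -mulr_suml big_split /= (@sum_fset_inj P (flip_coord j) Q).
  - by lra.
  - exact: inv_inj (flip_coordK j).
  - by move=> s; exact: flipP.
apply: eq_bigr => s _; rewrite /Q kernel_weight_flip -mulrDr -mulrA;
  congr (_ * _).
rewrite (bigD1 j) //= [X in _
  + X](bigD1 j) //= [RHS](bigD1 j) //= !mxE eqxx /bs (negbTE jJ) mem_head.
have rest (s' : 'rV[R]_d) : (forall l, l != j -> s' 0 l = s 0 l) ->
    \prod_(l < d | l != j) (if l \in J then (b l (s' 0 l) + b l (- s' 0 l)) / 2
      else b l (s' 0 l)) =
    \prod_(l < d | l != j) (if l \in j :: J then (b l (s 0 l)
      + b l (- s 0 l)) / 2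
      else b l (s 0 l)).
  by move=> ss; apply: eq_bigr => l lj; rewrite in_cons (negbTE lj) ss.
rewrite rest // rest; last by move=> l lj; rewrite mxE (negbTE lj).
by ring.
Qed.

Lemma quasi_discrete_opE (delta : R) (u : 'rV[R]_d -> R) x : 0 < delta ->
  quasi_discrete_op P rho delta u x =
  2 / delta ^+ 2 * \sum_(s <- P) kernel_weight s * (u (x + delta *: s) - u x).
Proof.
move=> delta0; have dn0 : delta != 0 by rewrite gt_eqF.
rewrite /quasi_discrete_op big_imfset /=; last first.
  by move=> s t _ _; exact: scalerI.
rewrite -mulrA; congr (_ * _); rewrite mulr_sumr; apply: eq_bigr => s _.
rewrite /scaled_weight /scaled_profile /kernel_weight scalerA mulVf // scale1r.
rewrite enormZ ?(ltW delta0) // [delta * _]mulrC mulfK // exprD.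
have : delta ^+ d != 0 by rewrite expf_neq0.
by move: (delta ^+ d) => D D0; field; rewrite D0 dn0.
Qed.

Lemma quasi_discrete_opB (delta : R) (u v : 'rV[R]_d -> R) x :
  quasi_discrete_op P rho delta (fun y => u y - v y) x =
  quasi_discrete_op P rho delta u x - quasi_discrete_op P rho delta v x.
Proof.
rewrite /quasi_discrete_op -mulrBr -sumrB; congr (_ * _).
by apply: eq_bigr => s _; ring.
Qed.

End quadrature_weights.

(** * Regularity of the extended solution *)

Section regularity.
Context {R : realType} {d : nat}.
Implicit Types (x y : 'rV[R]_d) (V W : 'rV[R]_d -> R) (js : seq 'I_d).

Lemma norm_le_coords (x : 'rV[R]_d) (B : R) : 0 <= B ->
  (forall j, `|x 0 j| <= B) -> `|x| <= B.
Proof.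
move=> B0 xB; rewrite [leLHS]/Num.norm /= mx_normrE; apply/bigmax_leP;
  split => //.
by move=> [i j] _ /=; rewrite ord1.
Qed.

Lemma coord_le_norm x j : `|x 0 j| <= `|x|.
Proof.
rewrite [leRHS]/Num.norm /= mx_normrE; apply/bigmax_geP; right => /=.
by exists (0, j).
Qed.

Lemma norm_le_enorm x : `|x| <= enorm x.
Proof. by apply: norm_le_coords (enorm_ge0 _) _ => j;
  exact: coord_le_enorm. Qed.

Lemma enorm_le_norm x : enorm x <= d%:R * `|x|.
Proof.
rewrite -[leRHS]ger0_norm ?mulr_ge0 // -sqrtr_sqr ler_wsqrtr //.
rewrite exprMn; apply: (@le_trans _ _ (d%:R * `|x| ^+ 2)).
  rewrite mulr_natl -[X in _ *+ X](card_ord d) -sumr_const ler_sum // => j _.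
  by rewrite -real_normK ?num_real // lerXn2r ?nnegrE ?coord_le_norm.
rewrite ler_wpM2r ?sqr_ge0 // expr2 -natrM ler_nat.
by case: (d) => // e; rewrite leq_pmulr.
Qed.

Lemma bounded_coords (A : set 'rV[R]_d) : bounded_set A ->
  exists2 D : R, 0 < D & forall x l, A x -> `|x 0 l| <= D.
Proof.
move=> [M [_ AM]]; exists (`|M| + 1); first by rewrite ltr_wpDl.
move=> x l Ax; apply: le_trans (coord_le_norm x l) _; apply: AM Ax.
by rewrite (le_lt_trans (ler_norm M)) // ltrDl.
Qed.

Lemma near_eq_partial V W j x :
  (\near x, V x = W x) -> \near x, partial j V x = partial j W x.
Proof.
move=> /near_join; apply: filterS => y VW; exact: near_eq_derive.
Qed.

Lemma near_eq_iter_partial V W js x :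
  (\near x, V x = W x) -> \near x, iter_partial js V x = iter_partial js W x.
Proof. by move=> VW; elim: js => //= j js; exact: near_eq_partial. Qed.

Lemma iter_partial0 js
  : iter_partial js (fun=> 0) = (fun=> 0) :> ('rV[R]_d -> R).
Proof.
elim: js => //= j js ->; apply/funext => x.
by rewrite /partial; exact: derive_cst.
Qed.

Variables (Omega : set 'rV[R]_d) (delta0 : R).
Hypothesis d_gt0 : (0 < d)%N.
Hypothesis delta0_gt0 : 0 < delta0.
Hypothesis Omega_domain : bounded_domain Omega.

Let has_inf_edist x : has_inf [set enorm (x - y) | y in Omega].
Proof.
have [[y Oy] _ _ _] := Omega_domain; split; first by exists (enorm (x - y));
  exists y.
by exists 0 => _ [z _ <-]; exact: enorm_ge0.
Qed.

Lemma closure_sub_interior_enlarge : closure Omega `<=` (enlarge Omega delta0)°.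
Proof.
(* Balls are taken in the sup norm. A point of the ball around [x] is within twice this radius of a
   point of Omega, and passing to the Euclidean norm costs at most a factor d. *)
move=> x clx; have e0 : 0 < delta0 / (2 * d%:R).
  by rewrite divr_gt0 // mulr_gt0 // ltr0n.
apply/nbhs_ballP; exists (delta0 / (2 * d%:R)) => //= y xy.
have [z [Oz xz]] := clx _ (nbhsx_ballx x _ e0).
have [Oy|nOy] := pselect (Omega y); [by left|right; split => //].
apply: (@le_trans _ _ (enorm (y - z))).
  by apply: (ge_inf (has_inf_edist y).2); exists z.
apply: le_trans (enorm_le_norm _) _.
rewrite mulrC -ler_pdivlMr ?ltr0n //.
move: xy xz; rewrite -!ball_normE /ball_ /= => xy xz.
rewrite (_ : y - z = (x - z) - (x - y));
  last by rewrite opprB [RHS]addrC addrA subrK.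
apply: (le_trans (ler_normB _ _)).
apply: (@le_trans _ _ (delta0 / (2 * d%:R) + delta0 / (2 * d%:R))).
  by rewrite lerD // ltW.
have : d%:R != 0 :> R by rewrite pnatr_eq0 -lt0n.
by move=> dn0; rewrite le_eqVlt; apply/orP; left; apply/eqP; field.
Qed.

Lemma compact_closure_enlarge : compact (closure (enlarge Omega delta0)).
Proof.
apply: bounded_closed_compact; last exact: closed_closure.
have [_ _ _ [M [Mr OM]]] := Omega_domain.
pose B := `|M| + 1 + (delta0 + 1).
have B0 : 0 < B by rewrite /B; move: (normr_ge0 M) delta0_gt0; lra.
have M1 : M < `|M| + 1 by rewrite (le_lt_trans (ler_norm M)) // ltrDl.
have EB : enlarge Omega delta0 `<=` closed_ball 0 B.
  rewrite closed_ballE // => x;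
    rewrite /closed_ball_ /= sub0r normrN => -[Ox|[_ xd]].
    by apply: (le_trans (OM _ M1 x Ox)); rewrite lerDl addr_ge0 // ltW.
  have [_ [y Oy <-] xy] := inf_adherent ltr01 (has_inf_edist x).
  rewrite -(subrK y x) (le_trans (ler_normD _ _)) // addrC lerD //.
    exact: OM M1 y Oy.
  by rewrite (le_trans (norm_le_enorm _)) // (le_trans (ltW xy)) // lerD2r.
exists B; split; first exact: num_real.
move=> r Br x clx; have : closed_ball 0 B x.
  have /closure_id E := @closed_ball_closed R _ (0 : 'rV[R]_d) B.
  by rewrite E; exact: closureS clx.
rewrite closed_ballE // /closed_ball_ /= sub0r normrN => xB.
exact: le_trans xB (ltW Br).
Qed.

Lemma within_continuous_bounded (A : set 'rV[R]_d) (g : 'rV[R]_d -> R) :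
  compact A -> {within A, continuous g} ->
  exists2 K, 0 <= K & forall x, A x -> `|g x| <= K.
Proof.
move=> cA cg; have := compact_bounded (continuous_compact cg cA).
move=> [M [Mr gM]]; exists `|M + 1| => // x Ax.
apply: le_trans (ler_norm _); apply: gM; first by rewrite ltrDl.
by exists x.
Qed.

Lemma zero_ext_near u x : Omega x -> \near x, zero_ext Omega u x = u x.
Proof.
have [_ oO _ _] := Omega_domain => Ox; near=> y.
by rewrite /zero_ext ifT // inE; near: y; exact: open_nbhs_nbhs.
Unshelve. all: by end_near. Qed.

Lemma zero_ext_near0 u x : ~ closure Omega x ->
  \near x, zero_ext Omega u x = 0.
Proof.
move=> clx; near=> y; rewrite /zero_ext ifF //; apply/negbTE;
  rewrite notin_setE.
suff : ~ closure Omega y by apply: contra_not; exact: subset_closure.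
by near: y; apply: open_nbhs_nbhs; split => //; rewrite openC;
  exact: closed_closure.
Unshelve. all: by end_near. Qed.

(** On the closure of Omega, which is interior to the enlargement, bounds come from the continuous
    extensions on a compact set; off the closure the function is locally 0. Global bounds on R^d
    result. *)
Lemma zero_ext_smooth_bounded u :
  Ck_closure 4 (enlarge Omega delta0) (zero_ext Omega u) ->
  exists K, smooth_bounded 4 K (zero_ext Omega u).
Proof.
move=> [_ Cu]; set U := zero_ext Omega u.
have bound js : exists K, 0 <= K /\ ((size js <= 4)%N ->
    forall x, `|iter_partial js U x| <= K).
  have [js4|_] := leqP (size js) 4; last by exists 0.
  have [_ [g cg gE]] := Cu js js4.
  have [K K0 gK] := within_continuous_bounded compact_closure_enlarge cg.
  exists K; split => // _ x; have [clx|nclx] := pselect (closure Omega x).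
    have xi := closure_sub_interior_enlarge clx.
    by rewrite -gE //; apply: gK; apply: subset_closure; exact: interior_subset.
  have /nbhs_singleton -> := near_eq_iter_partial js (zero_ext_near0 u nclx).
  by rewrite iter_partial0 normr0.
have [Kf KfP] := choice bound.
(* There are finitely many derivatives of order at most 4, and the sum of their nonnegative bounds
   dominates each. *)
exists (\sum_(n < 5) \sum_(t : n.-tuple 'I_d) Kf t) => js js4; split.
  move=> js4' j x; have [dU _] := Cu js js4.
  have [clx|nclx] := pselect (closure Omega x).
    by apply: dU => //; exact: closure_sub_interior_enlarge.
  have := near_eq_iter_partial js (zero_ext_near0 u nclx).
  rewrite iter_partial0 => E0.
  apply: (@near_eq_derivable _ _ _ (fun=> 0)); last exact: derivable_cst.
  by near do apply/esym.
move=> x; have [K0 Kjs] := KfP js; apply: le_trans (Kjs js4 x) _.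
rewrite (bigD1 (Ordinal (js4 : size js < 5)%N)) //= (bigD1 (in_tuple js)) //=.
rewrite -addrA lerDl addr_ge0 ?sumr_ge0 // => i _.
  by have [] := KfP i.
by rewrite sumr_ge0 // => t _; have [] := KfP t.
Unshelve. all: by end_near. Qed.

Lemma zero_ext_laplacian u x : Omega x ->
  laplacian (zero_ext Omega u) x = laplacian u x.
Proof.
move=> Ox; apply: eq_bigr => j _.
by have /nbhs_singleton := near_eq_iter_partial [:: j; j] (zero_ext_near u Ox).
Qed.

End regularity.

(** * Volumes of boxes and the L2 norm *)

Section boxes.
Context {R : realType}.

Definition tuple_box n (a w : 'I_n -> R) : set (n.-tuple (measurableTypeR R)) :=
  [set t | forall l, a l <= tnth t l <= a l + w l].

Lemma measurable_tuple_box n (a w : 'I_n -> R) : measurable (tuple_box a w).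
Proof.
rewrite (_ : tuple_box a w = \bigcap_(l in [set: 'I_n])
  ((fun t : n.-tuple (measurableTypeR R) => tnth t l) @^-1` `[a l, a l + w l])).
  apply: fin_bigcap_measurable => // l _; rewrite -[X in measurable X]setTI.
  by apply: (measurable_tnth l) => //; exact: measurable_itv.
apply/seteqP; split => [t bt l _|t bt l].
  by rewrite /= in_itv /=; exact: bt.
by have := bt l I; rewrite /= in_itv.
Qed.

Lemma lebesgue_tuple_box n (a w : 'I_n -> R) : (forall l, 0 <= w l) ->
  lebesgue_tuple n (tuple_box a w) = (\prod_l w l)%:E.
Proof.
elim: n a w => [|n IH] a w w0.
  rewrite big_ord0 /lebesgue_tuple /= diracE mem_set //.
  by move=> [].
rewrite /lebesgue_tuple /= /cons_measure /pushforward.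
have -> : @tuple_cons _ (measurableTypeR R) n @^-1` tuple_box a w =
    `[a ord0, a ord0 + w ord0]%classic `*`
    tuple_box (fun l => a (lift ord0 l)) (fun l => w (lift ord0 l)).
  apply/seteqP; split => [[x t] bt|[x t] [/= xI bt] l].
    split; first by have := bt ord0; rewrite /= in_itv.
    by move=> l; have := bt (lift ord0 l); rewrite tnthS.
  case: (unliftP ord0 l) => [l' ->|->].
    by rewrite tnthS; exact: bt.
  by rewrite tnth0; move: xI; rewrite in_itv.
rewrite product_measure1E /=; last 2 first.
- exact: measurable_itv.
- exact: measurable_tuple_box.
rewrite -/(lebesgue_tuple n) IH // big_ord_recl EFinM; congr (_ * _)%E.
rewrite lebesgue_measure_itv /= lte_fin ltrDl.
case: ltP => [_|wle]; first by rewrite -EFinD addrAC subrr add0r.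
by congr EFin; apply/eqP; rewrite eq_le w0.
Qed.

(** The integral of a nonnegative function is a supremum over simple functions below it, hence
    monotone for arbitrary functions. The measurability of the error thus never has to be
    established. *)
Lemma ge0_le_integral_nonmeasurable d (T : measurableType d)
    (mu : {measure set T -> \bar R}) (f g : T -> \bar R) :
  (forall x, 0 <= f x)%E -> (forall x, f x <= g x)%E ->
  (\int[mu]_x f x <= \int[mu]_x g x)%E.
Proof.
move=> f0 fg; rewrite !ge0_integralTE // => [|x]; last exact: le_trans (fg x).
apply: ereal_sup_le => _ [h hf <-]; exists h => //= x.
exact: le_trans (fg x).
Qed.

Lemma L2norm_on_le_boxes n (A : set 'rV[R]_n) (v : 'rV[R]_n -> R) (J : finType)
    (r : J -> R) (a w : J -> 'I_n -> R) :
  (forall j, 0 <= r j) -> (forall j l, 0 <= w j l) ->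
  (forall x, A x -> v x ^+ 2 <= \sum_(j | [forall l, a j l <= x 0 l <= a j l
    + w j l]) r j) ->
  (L2norm_on A v <= (Num.sqrt (\sum_j r j * \prod_l w j l))%:E)%E.
Proof.
move=> r0 w0 vr; set S := \sum_j _.
have S0 : 0 <= S by apply: sumr_ge0 => j _; rewrite mulr_ge0 ?prodr_ge0.
have intS : (\int[lebesgue_tuple n]_t
    (\sum_(j <- index_enum J) (r j)%:E
      * (\1_(tuple_box (a j) (w j)) t)%:E) = S%:E)%E.
  rewrite ge0_integral_sum //=.
  - rewrite -sumEFin; apply: eq_bigr => j _.
    rewrite ge0_integralZl_EFin //=.
    + rewrite integral_indic ?setIT;
      [|exact: measurableT|exact: measurable_tuple_box].
      by rewrite EFinM; congr (_ * _)%E; exact: lebesgue_tuple_box.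
    + apply/measurable_EFinP; apply: measurable_indic;
      exact: measurable_tuple_box.
  - move=> j; apply: measurable_funeM; apply/measurable_EFinP.
    by apply: measurable_indic; exact: measurable_tuple_box.
  - by move=> j t _; rewrite mule_ge0 // lee_fin.
rewrite /L2norm_on unlock -(powR12_sqrt S0) -poweR_EFin.
apply: gt0_ler_poweR.
- by rewrite invr_ge0.
- by rewrite in_itv /= leey andbT; apply: integral_ge0 => t _;
    rewrite lee_fin powR_ge0.
- by rewrite in_itv /= leey andbT lee_fin.
rewrite -intS; apply: ge0_le_integral_nonmeasurable => t;
  first exact: poweR_ge0.
rewrite abse_EFin poweR_EFin powR_mulrn // real_normK ?num_real //.
under eq_bigr do rewrite -EFinM; rewrite sumEFin lee_fin /zero_ext.
case: ifPn => [/set_mem At|_]; last first.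
  by rewrite expr0n; apply: sumr_ge0 => j _; rewrite mulr_ge0.
apply: (le_trans (vr _ At)); rewrite big_mkcond /=; apply: ler_sum => j _.
case: ifPn => [/forallP bt|_]; last by rewrite mulr_ge0.
rewrite indicE mem_set ?mulr1 // => l.
by have := bt l; rewrite mxE.
Qed.

End boxes.

(** * The collocation scheme *)

Section collocation_grid.
Context {R : realType} {d : nat}.
Variables (hv : 'rV[R]_d) (N : nat).
Hypothesis hv_gt0 : forall l, 0 < hv 0 l.

(* The nodes [((i l - N) * hv l)_l] with all |i l - N| <= N; [N] is taken so
   large that the box contains the grid points of Omega with some margin. *)
Local Notation index := {ffun 'I_d -> 'I_N.*2.+1}.
Implicit Types (x s : 'rV[R]_d) (i : index).

Definition node i : 'rV[R]_d := \row_l (((i l)%:R - N%:R) * hv 0 l).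

Definition shape i x : R :=
  \prod_l spline (x 0 l / hv 0 l - ((i l)%:R - N%:R)).

Definition interp (c : index -> R) x : R := \sum_i c i * shape i x.

Lemma interpB (b c : index -> R) x :
  interp (fun i => b i - c i) x = interp b x - interp c x.
Proof. by rewrite /interp -sumrB; apply: eq_bigr => i _; rewrite mulrBl. Qed.

Lemma node_coord i l : node i 0 l = ((i l)%:R - N%:R) * hv 0 l.
Proof. by rewrite mxE. Qed.

Let offset i : 'rV[int]_d := \row_l ((i l)%:Z - N%:Z).

Let offset_real i l : ((offset i) 0 l)%:~R = (i l)%:R - N%:R :> R.
Proof. by rewrite mxE rmorphB. Qed.

Let offset_inj : injective offset.
Proof.
move=> i j /rowP ij; apply/ffunP => l; apply/val_inj => /=.
by have := ij l; rewrite !mxE => /addIr[].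
Qed.

Lemma grid_node i : grid hv (node i).
Proof. by exists (offset i) => //; apply/rowP => l; rewrite !mxE rmorphB. Qed.

Let grid_point_offset i : grid_point hv (offset i) = node i.
Proof. by apply/rowP => l; rewrite !mxE rmorphB. Qed.

Lemma rk_basis_spline k x : rk_basis hv k x =
  \prod_l spline (x 0 l / hv 0 l - (k 0 l)%:~R).
Proof.
apply: eq_bigr => l _; rewrite /spline; congr window.
have h0 := hv_gt0 l; have hn0 : hv 0 l != 0 by rewrite gt_eqF.
have -> : x 0 l / hv 0 l - (k 0 l)%:~R = (x 0 l - (k 0 l)%:~R
  * hv 0 l) / hv 0 l.
  by field.
by rewrite normrM normfV (gtr0_norm h0) invfM; ring.
Qed.

(** A nonzero coefficient sits at a grid point of Omega, whose integer coordinates are at most [N]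
    in absolute value; the sum over all of Z^d thus reduces to the box. *)
Lemma trial_space_interp (Omega : set 'rV[R]_d) (D : R) u :
  (forall x l, Omega x -> `|x 0 l| <= D) -> (forall l, D <= N%:R * hv 0 l) ->
  trial_space hv Omega u ->
  exists2 c : index -> R, (forall i, ~ Omega (node i) -> c i = 0) &
    forall x, u x = interp c x.
Proof.
move=> OD DN [c c0 uE]; exists (c \o offset) => [i nO|x].
  by apply: c0 => -[_]; rewrite grid_point_offset.
rewrite uE (fsbigE (map offset (index_enum _))) //=.
- rewrite big_map /interp; apply: eq_big => [i|i _]; first by rewrite mem_set.
  rewrite rk_basis_spline; congr (_ * _).
  by apply: eq_bigr => l _; rewrite offset_real.
- by rewrite map_inj_uniq // index_enum_uniq.
move=> k _ kN; rewrite c0 ?mul0r // => -[_ Ok]; move/negP: kN; apply.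
have kN l : (`|k 0 l| <= N%:Z)%R.
  have := le_trans (OD _ l Ok) (DN l);
    rewrite mxE normrM (gtr0_norm (hv_gt0 l)).
  by rewrite ler_pM2r // -intr_norm -[N%:R]/(N%:Z%:~R) ler_int.
have lt l : (absz (k 0 l + N%:Z)%R < N.*2.+1)%N by have := kN l; lia.
apply/mapP; exists [ffun l => Ordinal (lt l)]; first exact: mem_index_enum.
by apply/rowP => l; rewrite !mxE ffunE /=; have := kN l; lia.
Qed.

Lemma shape_ge0 i x : 0 <= shape i x.
Proof. by apply: prodr_ge0 => l _; exact: spline_ge0. Qed.

Section partition_of_unity.
Variable x : 'rV[R]_d.
Hypothesis x_inside : forall l, `|x 0 l / hv 0 l| <= N%:R - 2.

Let a l (n : 'I_N.*2.+1) : R := spline (x 0 l / hv 0 l - (n%:R - N%:R)).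

Let a_sum1 l : \sum_n a l n = 1.
Proof. by have [] := spline_moments 0 (x_inside l). Qed.

Lemma shape_sum1 : \sum_i shape i x = 1.
Proof. by rewrite /shape -(bigA_distr_bigA a) big1. Qed.

(** Jensen's inequality for the convex weights [shape i x], obtained from a nonnegative variance.
    The boxes are the supports of the splines. *)
Lemma interp_sqr_le c :
  interp c x ^+ 2 <= \sum_(i | [forall l, node i 0 l - 2 * hv 0 l <= x 0 l
       <= node i 0 l - 2 * hv 0 l + 4 * hv 0 l]) c i ^+ 2.
Proof.
set m := interp c x.
have jensen : m ^+ 2 <= \sum_i c i ^+ 2 * shape i x.
  have : 0 <= \sum_i (c i - m) ^+ 2 * shape i x.
    by apply: sumr_ge0 => i _; rewrite mulr_ge0 ?sqr_ge0 ?shape_ge0.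
  have -> (e : R) : \sum_i (c i - e) ^+ 2 * shape i x =
    \sum_i c i ^+ 2 * shape i x - 2 * e * interp c x
      + e ^+ 2 * \sum_i shape i x.
    rewrite /interp !mulr_sumr -sumrB -big_split /=.
    by apply: eq_bigr => i _; ring.
  by rewrite shape_sum1 -/m; nra.
apply: le_trans jensen _; rewrite [leRHS]big_mkcond; apply: ler_sum => i _.
case: ifPn => [_|/forallPn[l nl]].
  rewrite -[leRHS]mulr1 ler_wpM2l ?sqr_ge0 //.
  apply: prodr_ile1 => l _; rewrite spline_ge0 spline_le1 //.
rewrite /shape (bigD1 l) //= spline_out ?mul0r ?mulr0 //.
rewrite leNgt; apply: contra nl; rewrite ltr_norml => /andP[lo hi].
have h0 := hv_gt0 l; have hn0 : hv 0 l != 0 by rewrite gt_eqF.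
move: lo hi; rewrite ltrBlDr ltrBrDr ltr_pdivlMr // ltr_pdivrMr // !mxE =>
  lo hi.
by apply/andP; split; lra.
Qed.

Lemma interp_error (h K : R) (U : 'rV[R]_d -> R) :
  (forall l, hv 0 l <= h) -> 0 <= h -> smooth_bounded 2 K U ->
  `|interp (fun i => U (node i)) x - U x| <= d%:R * (K * (2 * h) ^+ 2).
Proof.
move=> hvh h0 sU; pose z l (n : 'I_N.*2.+1) : R := (n%:R - N%:R)
  * hv 0 l - x 0 l.
have zE l n : z l n = hv 0 l * (n%:R - N%:R - x 0 l / hv 0 l + 0).
  by rewrite /z addr0 mulrBr mulrCA divff ?gt_eqF // mulr1 mulrC.
have := @avgs_order2 _ _ _ a z (fun l n =>
  spline_ge0 _) a_sum1 (2 * h) _ _ _ K U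
  (enum 'I_d) x sU.
rewrite size_enum_ord avgs_enum_sum //.
rewrite (_ : \sum_i _ = interp (fun i => U (node i)) x).
  apply.
  - move=> l n /spline_neq0 an; rewrite zE addr0 normrM (gtr0_norm (hv_gt0 l)).
    rewrite mulrC ler_pM ?(ltW (hv_gt0 l)) // distrC; exact: ltW.
  - by rewrite mulr_ge0.
  - move=> l; under eq_bigr do rewrite zE mulrCA.
    by rewrite -mulr_sumr; have [_ -> _ _] := spline_moments 0 (x_inside l);
      rewrite mulr0.
apply: eq_bigr => i _; rewrite mulrC /shape; congr (U _ * _).
by apply/rowP => l; rewrite !mxE /z addrC subrK.
Qed.

End partition_of_unity.

Section consistency.
Variables (h K : R) (U : 'rV[R]_d -> R) (k : index).
Hypothesis hv_le : forall l, hv 0 l <= h.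
Hypothesis h_ge0 : 0 <= h.
Hypothesis U_smooth : smooth_bounded 4 K U.

Let kap l : R := (k l)%:R - N%:R.

Lemma node_shift (v : 'rV[R]_d) l : (node k + v) 0 l / hv 0 l = kap l
  + v 0 l / hv 0 l.
Proof. by rewrite !mxE mulrDl mulfK ?gt_eqF. Qed.

(* [U] interpolated and then averaged over the sign changes of [v]. *)
Lemma symmetric_interp_expansion (v : 'rV[R]_d) (r : R) :
  (forall l, `|kap l| + `|v 0 l / hv 0 l| <= N%:R - 2) ->
  (forall l, `|v 0 l| <= r) -> 0 <= r ->
  `|\sum_i U (node i) * \prod_l
      ((spline (kap l + v 0 l / hv 0 l - ((i l)%:R - N%:R))
        + spline (kap l + - v 0 l / hv 0 l - ((i l)%:R - N%:R))) / 2)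
    - U (node k)
    - \sum_l ((v 0 l ^+ 2
        + hv 0 l ^+ 2 / 3) / 2) * partial l (partial l U) (node k)|
  <= d%:R ^+ 2 * (K * (2 * h + r) ^+ 4).
Proof.
move=> vN vr r0.
pose t l := v 0 l / hv 0 l.
(* Weights average the two positions [kap l + t l] and [kap l - t l], whereas offsets [z] are
   measured from the node between them; this is what makes the odd moments vanish. *)
pose a l (n : 'I_N.*2.+1) : R :=
  (spline (kap l + t l - (n%:R - N%:R))
    + spline (kap l - t l - (n%:R - N%:R))) / 2.
pose z l (n : 'I_N.*2.+1) : R := (n%:R - N%:R - kap l) * hv 0 l.
have tN l : `|kap l + t l|
  <= N%:R - 2 by rewrite (le_trans (ler_normD _ _)) // vN.
have tN' l : `|kap l - t l|
  <= N%:R - 2 by rewrite (le_trans (ler_normB _ _)) // vN.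
have zE l n : z l n = hv 0 l * (n%:R - N%:R - (kap l + t l)
  + t l) by rewrite /z; ring.
have zE' l n : z l n = hv 0 l * (n%:R - N%:R - (kap l - t l) + - t l).
  by rewrite /z; ring.
have momentE l p : \sum_n a l n * z l n ^+ p = hv 0 l ^+ p / 2 *
   (\sum_(n < N.*2.+1) spline (kap l + t l - (n%:R - N%:R))
        * (n%:R - N%:R - (kap l + t l) + t l) ^+ p
   + \sum_(n < N.*2.+1) spline (kap l - t l - (n%:R - N%:R))
        * (n%:R - N%:R - (kap l - t l) + - t l) ^+ p).
  rewrite -big_split mulr_sumr /=; apply: eq_bigr => n _.
  rewrite /a [LHS]mulrC -mulrA mulrDl mulrDr.
  by rewrite [in X in X + _]zE [in X in _ + X]zE' !exprMn; ring.
have [M0 M1 M2 M3] : [/\ forall l, \sum_n a l n = 1,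
    forall l, \sum_n a l n * z l n = 0,
    forall l, \sum_n a l n * z l n ^+ 2 = 2 * ((v 0 l ^+ 2
      + hv 0 l ^+ 2 / 3) / 2) &
    forall l, \sum_n a l n * z l n ^+ 3 = 0].
  split=> l; have [m0 m1 m2 m3] := spline_moments (t l) (tN l);
    have [n0 n1 n2 n3] := spline_moments (- t l) (tN' l).
  - by rewrite -mulr_suml big_split /= m0 n0; lra.
  - under eq_bigr do rewrite -[z _ _]expr1.
    rewrite momentE; under eq_bigr do rewrite expr1.
    under [X in _ + X]eq_bigr do rewrite expr1.
    by rewrite m1 n1 subrr mulr0.
  - have hn0 : hv 0 l != 0 by rewrite gt_eqF.
    by rewrite momentE m2 n2 /t; field.
  - by rewrite momentE m3 n3; ring.
have a0 l n : 0 <= a l n by rewrite divr_ge0 // addr_ge0 // spline_ge0.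
have := @avgs_order4 _ _ _ a z a0 M0 (2 * h + r) _ _ _ M1 M2 M3 K U
  (enum 'I_d) (node k) U_smooth.
rewrite size_enum_ord avgs_enum_sum // big_enum /=.
rewrite (_ : \sum_i _ = \sum_i U (node i) * \prod_l
      ((spline (kap l + v 0 l / hv 0 l - ((i l)%:R - N%:R))
        + spline (kap l + - v 0 l / hv 0 l - ((i l)%:R - N%:R))) / 2)).
  apply; last by rewrite addr_ge0 // mulr_ge0.
  move=> l n an; have h0 := hv_gt0 l.
  (* A contributing node lies within 2 grid units of one of the two shifted positions, which in turn
     are at most [r] away from the centre. *)
  have bound (y : R) : spline (y - (n%:R - N%:R)) != 0 -> `|y - kap l|
    <= `|t l| ->
      `|z l n| <= 2 * h + r.
    move=> /spline_neq0 yn yt.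
    rewrite /z normrM (gtr0_norm h0).
    have -> : n%:R - N%:R - kap l = - (y - (n%:R - N%:R)) + (y - kap l) by ring.
    apply: (@le_trans _ _ ((2 + `|t l|) * hv 0 l)).
      rewrite ler_wpM2r ?(ltW h0) // (le_trans (ler_normD _ _)) // normrN.
      by rewrite lerD // ltW.
    rewrite mulrDl lerD //.
      by rewrite ler_wpM2l.
    by rewrite /t normrM normfV (gtr0_norm h0) divfK ?gt_eqF.
  have [s0|s0] := eqVneq (spline (kap l + t l - (n%:R - N%:R))) 0.
    apply: (bound (kap l - t l)); last by rewrite addrC addKr normrN.
    by apply: contra an => /eqP s0'; rewrite /a s0 s0' addr0 mul0r.
  by apply: (bound (kap l + t l)) => //; rewrite addrC addKr.
apply: eq_bigr => i _; rewrite mulrC; congr (U _ * _).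
  by apply/rowP => l; rewrite !mxE /z /kap; ring.
by apply: eq_bigr => l _; rewrite /a /t mulNr.
Qed.

End consistency.
End collocation_grid.

Section collocation_operator.
Context {R : realType} {d : nat}.
Variables (hv : 'rV[R]_d) (N : nat) (P : {fset 'rV[R]_d}) (rho : R -> R).
Hypothesis hv_gt0 : forall l, 0 < hv 0 l.
Hypothesis d_gt0 : (0 < d)%N.
Hypothesis Psym : symmetric_points P.
Hypothesis rho_ge0 : forall r, 0 < r -> 0 <= rho r.
Hypothesis denom_neq0 : weight_denominator P rho != 0.
Local Notation index := {ffun 'I_d -> 'I_N.*2.+1}.
Local Notation kw := (kernel_weight P rho).
Local Notation node := (@node R d hv N).
Local Notation interp := (@interp R d hv N).

Lemma interp_shift (c : index -> R) k (v : 'rV[R]_d) :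
  interp c (node k + v) = \sum_i c i * \prod_l
    spline ((k l)%:R - N%:R + v 0 l / hv 0 l - ((i l)%:R - N%:R)).
Proof.
apply: eq_bigr => i _; congr (_ * _); apply: eq_bigr => l _.
by rewrite node_shift.
Qed.

Lemma interp_operator_consistent (h K delta : R) (U : 'rV[R]_d -> R) (k
  : index) :
  (forall l, hv 0 l <= h) -> 0 <= h -> 0 < delta -> smooth_bounded 4 K U ->
  (forall l, `|(k l)%:R - N%:R : R| + delta / hv 0 l <= N%:R - 2) ->
  `|quasi_discrete_op P rho delta (interp (fun i => U (node i))) (node k)
     - laplacian U (node k)|
  <= 2 / delta ^+ 2 * ((\sum_(s <- P) kw s)
       * (2 * (d%:R ^+ 2 * (K * (2 * h + delta) ^+ 4)))).
Proof.
move=> hvh h0 delta0 sU kN.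
pose A (v : 'rV[R]_d) := \sum_(i : index) U (node i) * \prod_l
      ((spline ((k l)%:R - N%:R + v 0 l / hv 0 l - ((i l)%:R - N%:R))
        + spline ((k l)%:R - N%:R + - v 0 l / hv 0 l - ((i l)%:R - N%:R))) / 2).
pose D l := partial l (partial l U) (node k).
pose E (v : 'rV[R]_d) := A v - U (node k)
  - \sum_l ((v 0 l ^+ 2 + hv 0 l ^+ 2 / 3) / 2) * D l.
set eps := d%:R ^+ 2 * (K * (2 * h + delta) ^+ 4).
have Eeps (v : 'rV[R]_d) : (forall l, `|v 0 l| <= delta) -> `|E v| <= eps.
  move=> vd; apply: symmetric_interp_expansion => //; last exact: ltW.
  move=> l; apply: le_trans (kN l); rewrite lerD2l normrM normfV.
  by rewrite (gtr0_norm (hv_gt0 l)) ler_pM2r // invr_gt0.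
have [_ P1 _ _] := Psym.
have Pd s : s \in P -> forall l, `|(delta *: s) 0 l| <= delta.
  move=> sP l; rewrite mxE normrM (gtr0_norm delta0) ger_pMr //.
  exact: le_trans (coord_le_enorm s l) (P1 s sP).
(* At each fixed node the basis function is a product of functions of the single coordinates of [s],
   so it may be symmetrised under the weighted sum. *)
have sumA : \sum_(s <- P) kw s * interp (fun i =>
  U (node i)) (node k + delta *: s)
    = \sum_(s <- P) kw s * A (delta *: s).
  under eq_bigr do rewrite interp_shift mulr_sumr.
  rewrite exchange_big /=; under [RHS]eq_bigr do rewrite mulr_sumr.
  rewrite [RHS]exchange_big /=; apply: eq_bigr => i _.
  pose b l (r : R) :=
    spline ((k l)%:R - N%:R + delta * r / hv 0 l - ((i l)%:R - N%:R)).
  transitivity (U (node i) * \sum_(s <- P) kw s * \prod_l b l (s 0 l)).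
    rewrite mulr_sumr; apply: eq_bigr => s _; rewrite mulrCA;
      congr (_ * (_ * _)).
    by apply: eq_bigr => l _; rewrite mxE.
  rewrite (sum_kernel_weight_even _ Psym) mulr_sumr; apply: eq_bigr => s _.
  rewrite mulrCA; congr (_ * (_ * _)); apply: eq_bigr => l _.
  by rewrite /b mxE mulrN.
have A0 : interp (fun i => U (node i)) (node k) = A 0.
  rewrite -[node k]addr0 interp_shift; apply: eq_bigr => i _; congr (_ * _).
  apply: eq_bigr => l _; rewrite !mxE oppr0 mul0r addr0; lra.
rewrite quasi_discrete_opE //.
under eq_bigr do rewrite mulrBr.
rewrite sumrB sumA A0 -sumrB.
under eq_bigr do rewrite -mulrBr.
have AE s : A (delta *: s) - A 0 = (E (delta *: s) - E 0)
    + \sum_l delta ^+ 2 / 2 * (s 0 l ^+ 2 * D l).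
  have -> : \sum_l delta ^+ 2 / 2 * (s 0 l ^+ 2 * D l) =
     \sum_l (((delta *: s) 0 l ^+ 2 + hv 0 l ^+ 2 / 3) / 2) * D l
     - \sum_l (((0 : 'rV[R]_d) 0 l ^+ 2 + hv 0 l ^+ 2 / 3) / 2) * D l.
    by rewrite -sumrB; apply: eq_bigr => l _; rewrite !mxE; ring.
  by rewrite /E; ring.
have -> : \sum_(s <- P) kw s * (A (delta *: s) - A 0) =
   \sum_(s <- P) kw s * (E (delta *: s) - E 0)
     + delta ^+ 2 / 2 * laplacian U (node k).
  under eq_bigr do rewrite AE mulrDr.
  rewrite big_split /=; congr (_ + _).
  under eq_bigr do rewrite mulr_sumr.
  rewrite exchange_big /= mulr_sumr; apply: eq_bigr => l _.
  rewrite -[partial l _ _]mul1r -(kernel_weight_normalized d_gt0 Psym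
    denom_neq0 l).
  by rewrite mulr_suml mulr_sumr; apply: eq_bigr => s _; rewrite /D; ring.
have d2 : 0 < 2 / delta ^+ 2 by rewrite divr_gt0 // exprn_gt0.
move: (laplacian U (node k)) => L; set S := \sum_(s <- P) _.
have -> : 2 / delta ^+ 2 * (S + delta ^+ 2 / 2 * L) - L = 2 / delta ^+ 2 * S.
  by field; rewrite gt_eqF.
rewrite normrM (gtr0_norm d2) ler_pM2l // mulr_suml.
apply: le_trans (ler_norm_sum _ _ _) _; rewrite big_seq [leRHS]big_seq.
apply: ler_sum => s sP; rewrite normrM ger0_norm ?kernel_weight_ge0 //.
rewrite ler_wpM2l ?kernel_weight_ge0 // (le_trans (ler_normB _ _)) //.
rewrite mulr_natl mulr2n lerD // Eeps //; first exact: Pd.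
by move=> l; rewrite mxE normr0 ltW.
Qed.

(** Values of a cubic spline at shifted nodes are hat correlations: collocation tested against its
    own coefficients is a Galerkin form for hats. *)
Lemma operator_energy (c : index -> R) (delta : R) : 0 < delta ->
  \sum_k c k * - quasi_discrete_op P rho delta (interp c) (node k) =
  2 / delta ^+ 2 * \sum_(s <- P) kw s *
    (energy c (fun i l => i l) (fun=> 0)
     - energy c (fun i l => i l) (fun l => delta * s 0 l / hv 0 l)).
Proof.
move=> delta0.
have interpE k (v : 'rV[R]_d) : interp c (node k + v) =
    \sum_i c i * \prod_l spline ((k l)%:R - (i l)%:R + v 0 l / hv 0 l).
  rewrite interp_shift; apply: eq_bigr => i _; congr (_ * _).
  by apply: eq_bigr => l _; congr spline; ring.
have energyE (v : 'rV[R]_d) : \sum_k c k * interp c (node k + v) =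
    energy c (fun i l => i l) (fun l => v 0 l / hv 0 l).
  apply: eq_bigr => k _; rewrite interpE mulr_sumr.
  by apply: eq_bigr => i _; rewrite mulrA.
under eq_bigr do rewrite quasi_discrete_opE // mulrN mulrCA -mulrN.
rewrite -mulr_sumr; congr (_ * _).
under eq_bigr do rewrite mulr_sumr -sumrN.
rewrite exchange_big; apply: eq_bigr => s _.
have -> : energy c (fun i l => i l) (fun=> 0) =
    \sum_k c k * interp c (node k + 0).
  by rewrite energyE; apply: eq_energy => l; rewrite mxE mul0r.
have -> : energy c (fun i l => i l) (fun l => delta * s 0 l / hv 0 l) =
    \sum_k c k * interp c (node k + delta *: s).
  by rewrite energyE; apply: eq_energy => l; rewrite mxE.
rewrite -sumrB mulr_sumr; apply: eq_bigr => k _; rewrite addr0; ring.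
Qed.

Lemma operator_stable (c : index -> R) (delta : R) (q : nat) s l :
  0 < delta -> s \in P -> 0 < kw s ->
  (N.*2)%:R + 2 <= 2 ^+ q * `|delta * s 0 l / hv 0 l| ->
  (1 / 3) ^+ d * \sum_i c i ^+ 2 <= 4 ^+ q * (delta ^+ 2 / (2 * kw s)) *
    \sum_k c k * - quasi_discrete_op P rho delta (interp c) (node k).
Proof.
move=> delta0 sP w0 qN; rewrite operator_energy //.
set E := energy c (fun i l => i l).
have leN (i : index) l' : (i l' <= N.*2)%N by rewrite -ltnS.
have width (i j : index) : `|(i l)%:R - (j l)%:R : R| <= (N.*2)%:R.
  have := leN i l; have := leN j l; rewrite -!(ler_nat R) => ? ?.
  have := ler0n R (i l); have := ler0n R (j l).
  by rewrite ler_norml => ? ?; apply/andP; split; lra.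
have coer := @energy_coercive R d _ c (fun (i : index) l => i l) N.*2 leN.
apply: (le_trans (coer _)).
  by move=> i j ij; apply/ffunP => l'; apply/val_inj/ij.
apply: (le_trans (energy_poincare c (t := fun l =>
  delta * s 0 l / hv 0 l) width qN)).
set S := \sum_(v <- P) _.
have -> : 4 ^+ q * (delta ^+ 2 / (2 * kw s)) * (2 / delta ^+ 2 * S) =
    4 ^+ q * (S / kw s).
  by move: (4 ^+ q) => Q; field; rewrite !gt_eqF.
(* Every term of [S] is nonnegative by [energy_le0], so [S] dominates the term of the single point
   [s]. *)
rewrite ler_wpM2l ?exprn_ge0 // ler_pdivlMr // mulrC /S (big_rem s) //=.
have El (v : 'rV[R]_d) : 0 <= kw v * (E (fun=> 0) - E (fun l =>
  delta * v 0 l / hv 0 l)).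
  by rewrite mulr_ge0 ?kernel_weight_ge0 // subr_ge0 energy_le0.
rewrite lerDl.

by apply: sumr_ge0.
Qed.

(** The lower bound separates the supports; the upper one keeps [4 ^+ q] of order h^-2. *)
Lemma exists_pow2 (X : R) : 0 <= X -> exists q, X <= 2 ^+ q <= 2 * X + 2.
Proof.
move=> X0; pose n := (Num.truncn X).+1.
have /andP[Xl Xu] := truncn_itv X0.
have /andP[nl nu] : (2 ^ trunc_log 2 n <= n < 2 ^ (trunc_log 2 n).+1)%N.
  by apply: trunc_log_bounds.
exists (trunc_log 2 n).+1; rewrite -natrX (le_trans (ltW Xu)) /=; last first.
  by rewrite ler_nat ltnW.
apply: (@le_trans _ _ (2 * n%:R)).
  by rewrite expnS natrM ler_wpM2l // ler_nat.
rewrite /n -natr1; lra.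
Qed.

End collocation_operator.

(** Young's inequality in each term, half of the squares being absorbed on the left. Terms with
    [e k = 0] contribute nothing, so [t] is controlled only at the others. *)
Lemma sum_sqr_le_of_energy (R : realFieldType) (I : finType) (e t
  : I -> R) (C B : R) :
  0 < C -> (forall k, e k = 0 \/ `|t k| <= B) ->
  \sum_k e k ^+ 2 <= C * \sum_k e k * t k ->
  \sum_k e k ^+ 2 <= (C * B) ^+ 2 * #|I|%:R.
Proof.
move=> C0 eB; set E := \sum_k e k ^+ 2 => EC.
have term k : C * (e k * t k) <= e k ^+ 2 / 2 + (C * B) ^+ 2 / 2.
  have [->|tB] := eB k.
    by rewrite mul0r mulr0 expr0n mul0r add0r divr_ge0 // sqr_ge0.
  have : t k ^+ 2 <= B ^+ 2.
    rewrite -[leLHS]real_normK ?num_real // lerXn2r ?nnegrE //.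
    exact: le_trans (normr_ge0 _) tB.
  move=> /(ler_wpM2l (sqr_ge0 C)); rewrite -!exprMn.
  have := sqr_ge0 (e k - C * t k); rewrite sqrrB mulrCA; lra.
have : C * \sum_k e k * t k <= E / 2 + (C * B) ^+ 2 / 2 * #|I|%:R.
  rewrite mulr_sumr; apply: (le_trans (ler_sum _ (fun k _ => term k))).
  by rewrite big_split /= -mulr_suml sumr_const mulr_natr.
by move: EC; lra.
Qed.

(** * Error estimate: consistency and stability combined with uniform constants *)

Theorem theorem6p4 (R : realType) (d : nat) (rho : R -> R)
    (hhat : 'rV[R]_d) (P : {fset 'rV[R]_d}) (Omega : set 'rV[R]_d)
    (delta0 M0 : R) (u0 : 'rV[R]_d -> R) (f : R -> 'rV[R]_d -> R) :
  (0 < d)%N ->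
  kernel_profile d rho ->
  grid_shape hhat ->
  symmetric_points P ->
  weight_denominator P rho != 0 ->
  bounded_domain Omega ->
  0 < delta0 ->
  0 < M0 ->
  poisson_solution Omega (f 0) u0 ->
  Ck_closure 4 (enlarge Omega delta0) (zero_ext Omega u0) ->
  (exists K : R, forall (delta : R) (x : 'rV[R]_d),
     0 < delta <= delta0 -> Omega x ->
     `|f delta x - f 0 x| <= K * delta ^+ 2) ->
  exists C : R, forall (delta hmax : R) (u : 'rV[R]_d -> R),
    0 < delta <= delta0 ->
    0 < hmax ->
    delta / hmax = M0 ->
    collocation_solution P rho (hmax *: hhat) Omega delta (f delta) u ->
    (L2norm_on Omega (u0 \- u)%R
       <= (C * (hmax ^+ 2 + delta ^+ 2))%R%:E)%E.
Proof.
move=> d_gt0 [rho_ge0 _ _ _] [hhat_gt0 hhat_max] Psym den Odom delta0_gt0 M0_gt0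
  [pois _] Cu [Kf fK].
have [K sU] := zero_ext_smooth_bounded d_gt0 delta0_gt0 Odom Cu.
have U0 x : ~ Omega x -> zero_ext Omega u0 x = 0.
  by move=> nOx; rewrite /zero_ext ifF //; apply/negbTE; rewrite notin_setE.
have UE x : Omega x -> zero_ext Omega u0 x = u0 x.
  by move=> Ox; rewrite /zero_ext ifT // inE.
have lapU x : Omega x -> laplacian (zero_ext Omega u0) x = - f 0 x.
  by move=> Ox; rewrite (zero_ext_laplacian Odom) // -pois // opprK.
move: (zero_ext Omega u0) sU U0 UE lapU => {Cu pois} U sU U0 UE lapU.
have K_ge0 := smooth_bounded_ge0 sU.
have [_ _ _ /bounded_coords[D D_gt0 OD]] := Odom.
have hhat_le1 l : hhat 0 l <= 1.
  by rewrite -hhat_max; exact: (le_bigmax _ (fun j => hhat 0 j) l).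
pose S : R := \sum_l (hhat 0 l)^-1.
have hhatV_le l : (hhat 0 l)^-1 <= S.
  rewrite /S (bigD1 l) //= lerDl sumr_ge0 // => j _.
  by rewrite invr_ge0 ltW.
have S_ge0 : 0 <= S by apply: sumr_ge0 => l _; rewrite invr_ge0 ltW.
have [s [sP ws [l0 sl0]]] := exists_kernel_weight_gt0 d_gt0 Psym rho_ge0 den.
pose H0 := delta0 / M0.
have H0_gt0 : 0 < H0 by rewrite divr_gt0.
(* A lower bound, uniform in [delta], for the shift by [delta *: s] along [l0] in grid units, since
   [hhat 0 l0 <= 1]. *)
pose tau := M0 * `|s 0 l0|.
have tau_gt0 : 0 < tau by rewrite mulr_gt0 // normr_gt0.
(* [D1] bounds (2N + 1)h, with 7 = 2 * 3 + 1 from N <= Y + 3, and [D2] bounds 2^q h. Stability has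
   constant [C3], the residual is at most [C4 * delta ^+ 2], and the interpolation error at most
   [C5 * h ^+ 2]. *)
pose D1 := 2 * ((D + delta0) * S) + 7 * H0.
pose D2 := 2 * (D1 + H0) / tau + 2 * H0.
pose C3 := 3 ^+ d * (D2 ^+ 2 * M0 ^+ 2 / (2 * kernel_weight P rho s)).
pose W := \sum_(v <- P) kernel_weight P rho v.
pose C4 := Kf + 2 * (W * (2 * (d%:R ^+ 2 * (K * (2 / M0 + 1) ^+ 4)))).
pose C5 := d%:R * (K * 4).
pose G1 := 2 * C5 ^+ 2 * (2 * D) ^+ d.
pose G2 := 2 * 4 ^+ d * (C3 * C4) ^+ 2 * D1 ^+ d.
have D1_gt0 : 0 < D1.
  have : 0 <= (D + delta0) * S by rewrite mulr_ge0 // addr_ge0 // ltW.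
  by rewrite /D1; move: H0_gt0; lra.
have D2_gt0 : 0 < D2.
  apply: addr_gt0; last exact: mulr_gt0.
  apply: divr_gt0 => //; apply: mulr_gt0 => //; exact: addr_gt0 D1_gt0 H0_gt0.
have C3_gt0 : 0 < C3.
  apply: mulr_gt0; first exact: exprn_gt0.
  by apply: divr_gt0; apply: mulr_gt0 => //; exact: exprn_gt0.
have C5_ge0 : 0 <= C5 by rewrite mulr_ge0 // mulr_ge0.
have G1_ge0 : 0 <= G1.
  apply: mulr_ge0; first by rewrite mulr_ge0 ?sqr_ge0.
  by apply: exprn_ge0; rewrite mulr_ge0 // ltW.
have G2_ge0 : 0 <= G2.
  apply: mulr_ge0; last exact: exprn_ge0 (ltW D1_gt0).
  by apply: mulr_ge0; [rewrite mulr_ge0 ?exprn_ge0|exact: sqr_ge0].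
exists (Num.sqrt (G1 + G2)) =>
  delta h u /andP[delta_gt0 delta_le] h_gt0 dh [ut ueq].
have deltaE : delta = M0 * h by rewrite -dh divfK ?gt_eqF.
have hE : h = delta / M0 by rewrite deltaE mulrC mulKf ?gt_eqF.
have h_le : h <= H0 by rewrite hE ler_pM2r // invr_gt0.
set hv := h *: hhat in ut ueq *.
have hvE l : hv 0 l = h * hhat 0 l by rewrite mxE.
have hv_gt0 l : 0 < hv 0 l by rewrite hvE mulr_gt0.
have hv_le l : hv 0 l <= h by rewrite hvE ger_pMr.
have hvV_le l (B : R) : 0 <= B -> B / hv 0 l <= B * S / h.
  move=> B0; rewrite hvE invfM [h^-1 * _]mulrC mulrA ler_pM2r ?invr_gt0 //.
  by rewrite ler_wpM2l.
pose Y := (D + delta0) * S / h.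
have Y_ge0 : 0 <= Y by rewrite !mulr_ge0 ?invr_ge0 ?(ltW h_gt0) // addr_ge0 //
  ltW.
(* [Y] bounds, in grid units, the coordinates of points of Omega enlarged by [delta]. Adding 3 after
   truncation yields [Y <= N%:R - 2], the margin required by the spline moments. *)
pose N := (Num.truncn Y + 3)%N.
have /andP[NYl NYu] := truncn_itv Y_ge0.
have NE : N%:R = (Num.truncn Y)%:R + 3 :> R by rewrite natrD.
have YN : Y <= N%:R - 2 by rewrite NE; move: NYu; rewrite -natr1; lra.
have NY : N%:R <= Y + 3 by rewrite NE lerD2r.
have Yh : Y * h = (D + delta0) * S by rewrite divfK ?gt_eqF.
have Nh : (N.*2.+1)%:R * h <= D1.
  rewrite -natr1 -addnn natrD.
  apply: (@le_trans _ _ ((Y + 3 + (Y + 3) + 1) * h)).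
    by rewrite ler_wpM2r ?(ltW h_gt0) // !lerD.
  rewrite (_ : _ * h = 2 * (Y * h) + 7 * h); last by ring.
  by rewrite Yh lerD2l ler_wpM2l.
have Yd l : D / hv 0 l + delta / hv 0 l <= Y.
  rewrite -mulrDl; apply: le_trans (hvV_le l _ _) _;
    first by rewrite addr_ge0 // ltW.
  by rewrite ler_wpM2r ?invr_ge0 ?(ltW h_gt0) // ler_wpM2r // lerD2l.
have inside x l : Omega x -> `|x 0 l| / hv 0 l + delta / hv 0 l <= N%:R - 2.
  move=> Ox; apply: le_trans YN; apply: le_trans (Yd l).
  by rewrite lerD2r ler_pM2r ?invr_gt0 // OD.
have inside0 x : Omega x -> forall l, `|x 0 l / hv 0 l| <= N%:R - 2.
  move=> Ox l; rewrite normrM normfV (gtr0_norm (hv_gt0 l)).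
  by apply: le_trans (inside x l Ox); rewrite lerDl divr_ge0 // ltW.
have DN l : D <= N%:R * hv 0 l.
  rewrite -ler_pdivrMr //; apply: (@le_trans _ _ Y).
    by apply: le_trans (Yd l); rewrite lerDl divr_ge0 // ltW.
  by move: YN; lra.
have [c c0 uE] := trial_space_interp hv_gt0 OD DN ut.
pose b := fun i : {ffun 'I_d -> 'I_N.*2.+1} => U (node hv i).
pose e := fun i => c i - b i.
have e0 i : ~ Omega (node hv i) -> e i = 0.
  by move=> nO; rewrite /e /b c0 // U0 // subrr.
have residual (k : {ffun 'I_d -> 'I_N.*2.+1}) : Omega (node hv k) ->
    `|- quasi_discrete_op P rho delta (interp hv e) (node hv k)| <= C4
      * delta ^+ 2.
  move=> Ok; have -> : interp hv e = (fun y => interp hv c y - interp hv b y).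
    by apply/funext => y; rewrite /e interpB.
  rewrite quasi_discrete_opB -(funext uE) opprB addrC.
  rewrite ueq; last by split => //; exact: grid_node.
  set F := quasi_discrete_op _ _ _ _ _.
  have -> : f delta (node hv k) + F = (f delta (node hv k) - f 0 (node hv k))
      + (F - laplacian U (node hv k)) by rewrite lapU //; ring.
  rewrite mulrDl (le_trans (ler_normD _ _)) // lerD ?fK ?delta_gt0 //.
  have kN l : `|(k l)%:R - N%:R : R| + delta / hv 0 l <= N%:R - 2.
    apply: le_trans (inside _ l Ok).
    by rewrite node_coord normrM (gtr0_norm (hv_gt0 l)) mulfK ?gt_eqF.
  have cons := interp_operator_consistent hv_gt0 d_gt0 Psym rho_ge0 den
     hv_le (ltW h_gt0) delta_gt0 sU kN.
  apply: (le_trans cons); rewrite -/W le_eqVlt; apply/orP; left; apply/eqP.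
  rewrite (_ : 2 * h + delta = (2 / M0 + 1) * delta); last first.
    by rewrite hE; field; rewrite gt_eqF.
  by move: (2 / M0 + 1) => mu; field; rewrite gt_eqF.
pose T := \sum_k e k
  * - quasi_discrete_op P rho delta (interp hv e) (node hv k).
have T_bound : \sum_k e k ^+ 2 <= C3 * T.
  have X_ge0 : 0 <= ((N.*2)%:R
    + 2) / tau by rewrite divr_ge0 // ?addr_ge0 // ltW.
  have [q /andP[ql qu]] := exists_pow2 X_ge0.
  have qt : (N.*2)%:R + 2 <= 2 ^+ q * `|delta * s 0 l0 / hv 0 l0|.
    apply: (@le_trans _ _ (2 ^+ q * tau)); first by rewrite -ler_pdivrMr.
    rewrite ler_wpM2l ?exprn_ge0 // /tau !normrM normfV (gtr0_norm delta_gt0).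
    rewrite (gtr0_norm (hv_gt0 l0)) ler_pdivlMr // mulrAC ler_wpM2r //.
    by rewrite deltaE ler_wpM2l // ltW.
  have st := operator_stable hv_gt0 d_gt0 Psym rho_ge0 den e delta_gt0 sP ws qt.
  rewrite -/T in st.
  have e2_ge0 : 0 <= \sum_i e i ^+ 2 by apply: sumr_ge0 => i _; exact: sqr_ge0.
  have third_gt0 : 0 < (1 / 3 : R) ^+ d by rewrite exprn_gt0 // divr_gt0.
  have coef_gt0 : 0 < 4 ^+ q * (delta ^+ 2 / (2 * kernel_weight P rho s)).
    by rewrite mulr_gt0 ?exprn_gt0 // divr_gt0 ?exprn_gt0 // mulr_gt0.
  (* The sign of [T] is needed in order to replace the [q]-dependent coefficient by the larger
     constant [C3]. *)
  have T_ge0 : 0 <= T.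
    rewrite -(pmulr_rge0 _ coef_gt0); apply: le_trans st.
    by rewrite mulr_ge0 // ltW.
  have qh : 2 ^+ q * h <= D2.
    apply: (@le_trans _ _ ((2 * (((N.*2)%:R + 2) / tau) + 2) * h)).
      by rewrite ler_wpM2r // ltW.
    rewrite (_ : _ * h = 2 * ((N.*2.+1)%:R * h + h) / tau + 2 * h); last first.
      by rewrite -natr1; field; rewrite gt_eqF.
    apply: lerD; last by rewrite ler_wpM2l.
    rewrite ler_wpM2r ?invr_ge0 ?(ltW tau_gt0) // ler_wpM2l //.
    exact: lerD.
  have q4 : 4 ^+ q * delta ^+ 2 <= D2 ^+ 2 * M0 ^+ 2.
    have le1 : 2 ^+ q * (M0 * h) <= D2 * M0.
      by rewrite mulrCA mulrC ler_wpM2r // ltW.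
    have ge1 : 0 <= 2 ^+ q * (M0
      * h) by rewrite mulr_ge0 ?exprn_ge0 // mulr_ge0 // ltW.
    rewrite deltaE (_ : 4 = 2 ^+ 2); last by ring.
    rewrite -exprM mulnC exprM -!exprMn lerXn2r ?nnegrE //.
    exact: le_trans le1.
  rewrite -(ler_pM2l third_gt0); apply: (le_trans st).
  have -> : (1 / 3) ^+ d * (C3 * T) =
      D2 ^+ 2 * M0 ^+ 2 / (2 * kernel_weight P rho s) * T.
    rewrite /C3 !mulrA -[_ ^+ d * _ ^+ d]exprMn (_ : 1 / 3 * 3 = 1);
      last by field.
    by rewrite expr1n mul1r.
  rewrite ler_wpM2r // [leLHS]mulrA ler_wpM2r // invr_ge0 mulr_ge0 //;
    exact: ltW.
have e2_bound : \sum_k e k ^+ 2 <= (C3 * C4) ^+ 2 * delta ^+ 4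
  * (N.*2.+1)%:R ^+ d.
  have := sum_sqr_le_of_energy (C3_gt0) (B := C4 * delta ^+ 2) _ T_bound.
  rewrite card_ffun !card_ord natrX (_ : (_ * (C4 * _)) ^+ 2 =
    (C3 * C4) ^+ 2 * delta ^+ 4); last by ring.
  apply=> k; have [Ok|nOk] := pselect (Omega (node hv k)).
    by right; exact: residual.
  by left; exact: e0.
(* The left summand is one large box containing Omega, for the interpolation error; the right one
   lists the spline supports, for the coefficient error. The factors 2 come from squaring a sum of
   two errors. *)
pose r (j : 'I_1 + {ffun 'I_d -> 'I_N.*2.+1}) : R :=
  if j is inr i then 2 * e i ^+ 2 else 2 * (C5 * h ^+ 2) ^+ 2.
pose a (j : 'I_1 + {ffun 'I_d -> 'I_N.*2.+1}) l : R :=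
  if j is inr i then node hv i 0 l - 2 * hv 0 l else - D.
pose w (j : 'I_1 + {ffun 'I_d -> 'I_N.*2.+1}) l : R :=
  if j is inr i then 4 * hv 0 l else 2 * D.
have r_ge0 j : 0 <= r j by case: j => *; rewrite mulr_ge0 ?sqr_ge0.
have w_ge0 j l : 0 <= w j l by case: j => *; rewrite mulr_ge0 // ltW.
apply: le_trans (@L2norm_on_le_boxes R d Omega (u0 \- u) _ r a w r_ge0 w_ge0
  _) _.
  move=> x Ox /=; rewrite -UE // uE.
  have ie := interp_error hv_gt0 (inside0 x Ox) hv_le (ltW h_gt0)
    (smooth_bounded_le (isT : (2 <= 4)%N) sU).
  have E2 := interp_sqr_le hv_gt0 (inside0 x Ox) e.
  rewrite big_mkcond big_sumType /= big_ord1 -big_mkcond /= ifT; last first.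
    by apply/forallP => l; have := OD x l Ox; rewrite ler_norml => /andP[? ?];
       apply/andP; split; lra.
  rewrite -mulr_sumr.
  have ebE : interp hv e x = interp hv c x - interp hv b x by rewrite interpB.
  have eb2 : (interp hv b x - U x) ^+ 2 <= (C5 * h ^+ 2) ^+ 2.
    rewrite -[leLHS]real_normK ?num_real // lerXn2r ?nnegrE //.
      exact: mulr_ge0 C5_ge0 (sqr_ge0 h).
    by apply: (le_trans ie); rewrite le_eqVlt; apply/orP; left; apply/eqP;
      rewrite /C5; ring.
  have : (U x - interp hv c x) ^+ 2 <=
      2 * (interp hv b x - U x) ^+ 2 + 2 * interp hv e x ^+ 2.
    rewrite -subr_ge0 ebE (_ : _ - _ =
      (interp hv b x - U x - (interp hv c x - interp hv b x)) ^+ 2) ?sqr_ge0 //.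
    by ring.
  by move/le_trans; apply; rewrite lerD // ler_wpM2l.
rewrite lee_fin -[X in _ <= _ * X]ger0_norm ?addr_ge0 ?sqr_ge0 //.
rewrite -[X in _ * X]sqrtr_sqr -sqrtrM ?addr_ge0 // ler_wsqrtr // big_sumType
  /= big_ord1.
rewrite prodr_const card_ord.
have small : \sum_i 2 * e i ^+ 2 * \prod_l (4 * hv 0 l) <=
    G2 * delta ^+ 4.
  apply: (@le_trans _ _ (2 * (4 * h) ^+ d * \sum_i e i ^+ 2)).
    rewrite mulr_sumr; apply: ler_sum => i _.
    have -> : (4 * h) ^+ d = \prod_(l < d) (4
      * h) by rewrite prodr_const card_ord.
    rewrite [leRHS]mulrAC; apply: ler_wpM2l;
      first by rewrite mulr_ge0 // sqr_ge0.
    apply: ler_prod => l _.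
    by rewrite mulr_ge0 ?(ltW (hv_gt0 l)) // ler_wpM2l.
  have h4 : 0 <= 2 * (4
    * h) ^+ d by rewrite mulr_ge0 // exprn_ge0 // mulr_ge0 // ltW.
  apply: (le_trans (ler_wpM2l h4 e2_bound)).
  (* The support volume is paired with the number of nodes: the product of (2N + 1)^d and h^d is at
     most [D1 ^+ d]. *)
  have -> : 2 * (4 * h) ^+ d * ((C3 * C4) ^+ 2 * delta ^+ 4
    * (N.*2.+1)%:R ^+ d) =
     2 * 4 ^+ d * (C3 * C4) ^+ 2 * ((N.*2.+1)%:R * h) ^+ d * delta ^+ 4.
    by rewrite !exprMn; ring.
  apply: ler_wpM2r; first exact: exprn_ge0 (ltW delta_gt0).
  apply: ler_wpM2l; first by rewrite mulr_ge0 ?sqr_ge0 // mulr_ge0 // exprn_ge0.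
  rewrite lerXn2r ?nnegrE ?(ltW D1_gt0) //.
  by rewrite mulr_ge0 // ltW.
have h2 : 0 <= h ^+ 2 by exact: sqr_ge0.
have dl2 : 0 <= delta ^+ 2 by exact: sqr_ge0.
apply: (@le_trans _ _ (G1 * (h ^+ 2) ^+ 2 + G2 * (delta ^+ 2) ^+ 2)).
  apply: lerD; last by rewrite -exprM.
  by rewrite le_eqVlt; apply/orP; left; apply/eqP; rewrite /G1; ring.
have sq1 : (h ^+ 2) ^+ 2 <= (h ^+ 2 + delta ^+ 2) ^+ 2.
  by rewrite lerXn2r ?nnegrE ?addr_ge0 // lerDl.
have sq2 : (delta ^+ 2) ^+ 2 <= (h ^+ 2 + delta ^+ 2) ^+ 2.
  by rewrite lerXn2r ?nnegrE ?addr_ge0 // lerDr.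
by rewrite mulrDl lerD // ler_wpM2l.
Qed.
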